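(* Let $\mathfrak g$ be a connected Lie ring definable in a finite-dimensional theory. Then there exists a series $$\mathfrak g=\mathfrak h_0\ge \mathfrak h_1\ge\dots\ge\mathfrak h_n=\{0\}$$ of definable ideals of $\mathfrak g$ such that, for each $i$, $\mathfrak h_i/\mathfrak h_{i+1}$ is either abelian, or it is connected, $\mathfrak g$-minimal and has the DCC.
   Context: A first-order theory $T$ is finite-dimensional if there is a function $\dim$ from the class of all interpretable sets in models of $T$ to $\omega\cup\{-\infty\}$ such that, for every formula $\varphi(x,y)$, all interpretable sets $X,Y$ and every interpretable function $f:X\to Y$: (1) if $a,a'$ have the same type over $\emptyset$ then $\dim\varphi(x,a)=\dim\varphi(x,a')$; (2) $\dim\emptyset=-\infty$, and $\dim X=0$ iff $X$ is finite (nonempty); (3) $\dim(X\cup Y)=\max\{\dim X,\dim Y\}$; (4) if $\dim f^{-1}(y)\ge k$ for all $y\in Y$ then $\dim X\ge \dim Y+k$; (5) if $\dim f^{-1}(y)\le k$ for all $y\in Y$ then $\dim X\le\dim Y+k$. A Lie ring is an abelian group $(\mathfrak g,+)$ with a biadditive antisymmetric bracket satisfying the Jacobi identity. A definable group (or Lie ring, via its additive group) is connected if it has no proper definable subgroup of finite index. A quotient $\mathfrak h_i/\mathfrak h_{i+1}$ of ideals is a $\mathfrak g$-module via the bracket; it is $\mathfrak g$-minimal if it has no infinite definable $\mathfrak g$-invariant subgroup of infinite index. It has the DCC if its additive group admits no infinite strictly descending chain of definable subgroups. *)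

(* Defs.v *)
From HB Require Import structures.
From mathcomp Require Import all_boot all_order all_algebra.
From mathcomp Require Import mathcomp_extra boolp classical_sets functions.
From mathcomp Require Import cardinality.

Set Implicit Arguments.
Unset Strict Implicit.
Unset Printing Implicit Defensive.

Import GRing.Theory.
Local Open Scope classical_set_scope.
Local Open Scope ring_scope.
Local Open Scope quotient_scope.

Record language := Language {
  fsym : Type; farity : fsym -> nat;
  rsym : Type; rarity : rsym -> nat }.

(* The parameter V is the type of free variables: a formula phi(x, y) in tuples
   of variables x, y of lengths n, m has type [formula L ('I_n + 'I_m)], and a
   sentence has type [formula L void]. *)
Inductive term (L : language) (V : Type) : Type :=
| TVar of V
| TApp (f : fsym L) of ('I_(farity f) -> term L V).

Inductive formula (L : language) (V : Type) : Type :=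
| FEq of term L V & term L V
| FRel (r : rsym L) of ('I_(rarity r) -> term L V)
| FFalse
| FImp of formula L V & formula L V
| FAll of formula L (option V).

Record fo_structure (L : language) := FOStructure {
  carrier :> Type;
  carrier_inhabited : inhabited carrier;
  finterp : forall f : fsym L, ('I_(farity f) -> carrier) -> carrier;
  rinterp : forall r : rsym L, ('I_(rarity r) -> carrier) -> Prop }.

Fixpoint teval L (M : fo_structure L) V (v : V -> M) (t : term L V) : M :=
  match t with
  | TVar i => v i
  | TApp f ts => finterp (fun i => teval v (ts i))
  end.

Fixpoint sat L (M : fo_structure L) V (v : V -> M) (phi : formula L V) : Prop :=
  match phi with
  | FEq s t => teval v s = teval v t
  | FRel r ts => rinterp (fun i => teval v (ts i))
  | FFalse => False
  | FImp p q => sat v p -> sat v q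
  | FAll p => forall a : M, sat (fun o => oapp v a o) p
  end.

Definition theory (L : language) := set (formula L void).

Definition models L (M : fo_structure L) (T : theory L) :=
  forall phi, T phi -> sat (of_void M) phi.

Definition same_type L m (M N : fo_structure L) (a : 'I_m -> M) (b : 'I_m -> N) :=
  forall phi : formula L 'I_m, sat a phi <-> sat b phi.

Definition join (A B X : Type) (x : A -> X) (y : B -> X) (s : A + B) : X :=
  match s with inl i => x i | inr j => y j end.

(* phi(M, a), the set defined by phi(x, y) with the parameters a for y. *)
Definition defset L (M : fo_structure L) V m
    (phi : formula L (V + 'I_m)) (a : 'I_m -> M) : set (V -> M) :=
  [set x | sat (join x a) phi].

(* With parameters from M. *)
Definition definable L (M : fo_structure L) V (D : set (V -> M)) :=
  exists m (phi : formula L (V + 'I_m)) (a : 'I_m -> M), D = defset phi a.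

(* An interpretable set is a quotient D/E of a definable set D of n-tuples by a
   definable equivalence relation E on D (a set of 2n-tuples); it is represented
   as the set of the E-classes, each class being a set of n-tuples. *)
Definition equivalence_on (X : Type) n (D : set ('I_n -> X))
    (E : set ('I_n + 'I_n -> X)) :=
  [/\ forall x, D x -> E (join x x),
      forall x y, D x -> D y -> E (join x y) -> E (join y x) &
      forall x y z, D x -> D y -> D z ->
        E (join x y) -> E (join y z) -> E (join x z)].

Definition classes (X : Type) n (D : set ('I_n -> X))
    (E : set ('I_n + 'I_n -> X)) : set (set ('I_n -> X)) :=
  [set [set y | D y /\ E (join x y)] | x in D].

Definition interpretable L (M : fo_structure L) n (X : set (set ('I_n -> M))) :=
  exists D E, [/\ definable D, definable E, equivalence_on D E & X = classes D E].

(* f maps X to Y, and the pull-back of its graph to tuples is definable. *)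
Definition interpretable_fun L (M : fo_structure L) n m
    (X : set (set ('I_n -> M))) (Y : set (set ('I_m -> M)))
    (f : set ('I_n -> M) -> set ('I_m -> M)) :=
  (forall C, X C -> Y (f C)) /\
  definable [set v | exists x y, v = join x y /\ exists2 C, X C & C x /\ f C y].

(* The values of a dimension: omega together with -oo, which is [None]. *)
Definition dimval := option nat.

Definition dimval_le (a b : dimval) : bool :=
  match a, b with
  | None, _ => true
  | Some _, None => false
  | Some i, Some j => (i <= j)%N
  end.

Definition dimval_max (a b : dimval) : dimval := if dimval_le a b then b else a.

Definition dimval_add (a : dimval) (k : nat) : dimval := omap (addn^~ k) a.

(* Only the values of dim at interpretable sets in models of T matter.
   In the first axiom a and a' may live in different models of T, and the
   formulas delta(x, y), eps(x, x', y) give a family of interpretable sets. *)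
Record dimension_axioms L (T : theory L)
    (dim : forall (M : fo_structure L) n, set (set ('I_n -> M)) -> dimval) : Prop := {
  dim_invariant : forall (M N : fo_structure L), models M T -> models N T ->
    forall n m (delta : formula L ('I_n + 'I_m))
      (eps : formula L (('I_n + 'I_n) + 'I_m)) (a : 'I_m -> M) (a' : 'I_m -> N),
    equivalence_on (defset delta a) (defset eps a) ->
    equivalence_on (defset delta a') (defset eps a') ->
    same_type a a' ->
    dim M n (classes (defset delta a) (defset eps a)) =
    dim N n (classes (defset delta a') (defset eps a'));
  dim_empty : forall (M : fo_structure L), models M T ->
    forall n, dim M n set0 = None;
  dim_finite : forall (M : fo_structure L), models M T ->
    forall n (X : set (set ('I_n -> M))), interpretable X ->
    dim M n X = Some 0%N <-> finite_set X /\ X !=set0;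
  dim_union : forall (M : fo_structure L), models M T ->
    forall n (X Y : set (set ('I_n -> M))),
    interpretable X -> interpretable Y -> interpretable (X `|` Y) ->
    dim M n (X `|` Y) = dimval_max (dim M n X) (dim M n Y);
  dim_fibre_ge : forall (M : fo_structure L), models M T ->
    forall n m (X : set (set ('I_n -> M))) (Y : set (set ('I_m -> M))) f (k : nat),
    interpretable X -> interpretable Y -> interpretable_fun X Y f ->
    (forall y, Y y -> dimval_le (Some k) (dim M n (X `&` f @^-1` [set y]))) ->
    dimval_le (dimval_add (dim M m Y) k) (dim M n X);
  dim_fibre_le : forall (M : fo_structure L), models M T ->
    forall n m (X : set (set ('I_n -> M))) (Y : set (set ('I_m -> M))) f (k : nat),
    interpretable X -> interpretable Y -> interpretable_fun X Y f ->
    (forall y, Y y -> dimval_le (dim M n (X `&` f @^-1` [set y])) (Some k)) ->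
    dimval_le (dim M n X) (dimval_add (dim M m Y) k) }.

Definition finite_dimensional L (T : theory L) :=
  exists dim, @dimension_axioms L T dim.

HB.mixin Record Zmodule_isLieRing (G : Type) of GRing.Zmodule G := {
  lie : G -> G -> G;
  lieDl : forall x y z, lie (x + y) z = lie x z + lie y z;
  lieDr : forall x y z, lie x (y + z) = lie x y + lie x z;
  lieC : forall x y, lie x y = - lie y x;
  jacobi : forall x y z, lie x (lie y z) + lie y (lie z x) + lie z (lie x y) = 0
}.

#[short(type="lieRingType")]
HB.structure Definition LieRing := {G of Zmodule_isLieRing G & GRing.Zmodule G}.

HB.mixin Record isLieClosed (G : lieRingType) (S : G -> bool) := {
  lie_closed_subproof : forall x y, y \in S -> lie x y \in S
}.

#[short(type="lieIdeal")]
HB.structure Definition LieIdeal (G : lieRingType) :=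
  {S of GRing.ZmodClosed G S & isLieClosed G S}.

Section QuotientLieRing.
Variables (G : lieRingType) (I : lieIdeal G).

Definition quot_lie (p q : {ideal_quot I}) : {ideal_quot I} :=
  \pi_{ideal_quot I} (lie (repr p) (repr q)).

Lemma lie_idealr (x y : G) : y \in I -> lie x y \in I.
Proof. exact: lie_closed_subproof. Qed.

Lemma lie_ideall (x y : G) : x \in I -> lie x y \in I.
Proof. by move=> xI; rewrite lieC rpredN lie_idealr. Qed.

Lemma quot_lie_pi (x y : G) :
  quot_lie (\pi_{ideal_quot I} x) (\pi_{ideal_quot I} y) = \pi_{ideal_quot I} (lie x y).
Proof.
have lieNl (u v : G) : lie (- u) v = - lie u v.
  have lie0 : lie 0 v = 0 by apply: (addrI (lie 0 v)); rewrite -lieDl !addr0.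
  by apply: (addrI (lie u v)); rewrite -lieDl !subrr.
apply/eqP; rewrite -Quotient.idealrBE.
set x' := repr _; set y' := repr _.
have x'x : x' - x \in I by rewrite Quotient.idealrBE /x' reprK.
have y'y : y' - y \in I by rewrite Quotient.idealrBE /y' reprK.
have -> : lie x' y' - lie x y = lie (x' - x) y' + lie x (y' - y).
  rewrite lieDl lieNl lieDr (lieC x (- y)) lieNl opprK (lieC y x).
  by rewrite addrA subrK.
by apply: rpredD; [exact: lie_ideall | exact: lie_idealr].
Qed.

Let piD (x y : G) :
  \pi_{ideal_quot I} (x + y) = \pi_{ideal_quot I} x + \pi_{ideal_quot I} y.
Proof. exact: raddfD. Qed.

Fact quot_lieDl (x y z : {ideal_quot I}) :
  quot_lie (x + y) z = quot_lie x z + quot_lie y z.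
Proof.
elim/quotW: x => x; elim/quotW: y => y; elim/quotW: z => z.
by rewrite -piD !quot_lie_pi lieDl piD.
Qed.

Fact quot_lieDr (x y z : {ideal_quot I}) :
  quot_lie x (y + z) = quot_lie x y + quot_lie x z.
Proof.
elim/quotW: x => x; elim/quotW: y => y; elim/quotW: z => z.
by rewrite -piD !quot_lie_pi lieDr piD.
Qed.

Fact quot_lieC (x y : {ideal_quot I}) : quot_lie x y = - quot_lie y x.
Proof.
elim/quotW: x => x; elim/quotW: y => y.
by rewrite !quot_lie_pi lieC; exact: raddfN.
Qed.

Fact quot_jacobi (x y z : {ideal_quot I}) :
  quot_lie x (quot_lie y z) + quot_lie y (quot_lie z x)
  + quot_lie z (quot_lie x y) = 0.
Proof.
elim/quotW: x => x; elim/quotW: y => y; elim/quotW: z => z.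
rewrite (quot_lie_pi y z) (quot_lie_pi z x) (quot_lie_pi x y) !quot_lie_pi.
by rewrite -!piD jacobi; exact: raddf0.
Qed.

HB.instance Definition _ := Zmodule_isLieRing.Build {ideal_quot I}
  quot_lieDl quot_lieDr quot_lieC quot_jacobi.

End QuotientLieRing.

Section DefinableGroups.
(* Def is the collection of the definable subsets of the abelian group A, and H
   is (the underlying set of) a subgroup of A. *)
Variables (A : zmodType) (Def : set (set A)) (H : set A).

Definition finite_index (K : zmodClosed A) :=
  finite_set [set [set y | y - x \in K] | x in H].

Definition connected_group := ~ exists K : zmodClosed A,
  [/\ Def [set` K], [set` K] `<` H & finite_index K].

Definition dcc_group := ~ exists K : nat -> zmodClosed A,
  forall i, [/\ Def [set` K i], [set` K i] `<=` H & [set` K i.+1] `<` [set` K i]].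

End DefinableGroups.

(* The quotient h/k is handled as a subgroup of the Lie ring g/k. *)
Definition quot_set (g : lieRingType) (h k : lieIdeal g) : set {ideal_quot k} :=
  [set \pi_{ideal_quot k} x | x in [set` h]].
Arguments quot_set {g} h k _.

Definition abelian_quot (g : lieRingType) (h k : lieIdeal g) :=
  forall x y, quot_set h k x -> quot_set h k y -> lie x y = 0.

Definition lie_invariant (g : lieRingType) (k : lieIdeal g)
    (S : zmodClosed {ideal_quot k}) :=
  forall (x : g) (y : {ideal_quot k}), y \in S -> lie (\pi_{ideal_quot k} x) y \in S.

Section DefinableLieRings.
(* The domain of a Lie ring g definable in M is a definable set of n-tuples; it is
   identified with the abstract Lie ring g by an injection c : g -> M^n. *)
Variables (L : language) (M : fo_structure L) (g : lieRingType) (n : nat).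
Variable c : g -> ('I_n -> M).

Definition definable_lie_ring :=
  [/\ injective c, definable (range c),
      definable [set v | exists x y, v = join (join (c x) (c y)) (c (x + y))] &
      definable [set v | exists x y, v = join (join (c x) (c y)) (c (lie x y))]].

Definition definable_in (S : set g) := definable (c @` S).

(* A subset of g/k is definable (in M^eq) iff its preimage in g is. *)
Definition definable_in_quot (k : lieIdeal g) (S : set {ideal_quot k}) :=
  definable_in [set x | S (\pi_{ideal_quot k} x)].

Definition minimal_quot (h k : lieIdeal g) := ~ exists S : zmodClosed {ideal_quot k},
  [/\ definable_in_quot [set` S], [set` S] `<=` quot_set h k, lie_invariant S,
      infinite_set [set` S] & ~ finite_index (quot_set h k) S].

Definition connected_quot (h k : lieIdeal g) :=
  connected_group (@definable_in_quot k) (quot_set h k).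

Definition dcc_quot (h k : lieIdeal g) :=
  dcc_group (@definable_in_quot k) (quot_set h k).

End DefinableLieRings.

(* Main.v *)
(* Take k maximal (for the dimension) among the connected definable ideals
   properly contained in a connected ideal h, and let Z be the set of the x in h
   with [g, x] in k, so that Z/k is abelian. If J is an ideal between Z and h,
   then k + [g, J] is a connected ideal, hence it is k or h, and J is Z or h. So
   h/Z has no proper nonzero definable g-submodule, and if it is not abelian it
   remains to find the DCC. The point is to find in h/Z a connected
   definable subgroup A all of whose proper definable subgroups are finite: h/Z
   is then a finite sum of images of A under iterated brackets, and the DCC
   passes from A to this sum.
   To find A, take an infinite definable K <= h/Z of minimal dimension and a
   finite sum S of subgroups [x, K] almost containing all of them. Computing the
   dimension of {(y, x) in K x g : [x, y] in S} along both projections shows that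
   [g, y] <= S for almost all y in K. So S contains a connected group [g, y] <> 0,
   and one of the summands [x, K] must have a connected subgroup of finite index,
   up to a finite group. *)

Require Import Defs.
From HB Require Import structures.
From mathcomp Require Import all_boot all_order all_algebra.
From mathcomp Require Import mathcomp_extra boolp classical_sets functions.
From mathcomp Require Import cardinality.

Set Implicit Arguments.
Unset Strict Implicit.
Unset Printing Implicit Defensive.

Import GRing.Theory.
Local Open Scope classical_set_scope.
Local Open Scope ring_scope.
Local Open Scope quotient_scope.

(** * Definable sets and coded predicates *)

Section Renaming.
Variables (L : language) (M : fo_structure L).

Fixpoint term_rename V W (f : V -> W) (t : term L V) : term L W :=
  match t with
  | TVar i => TVar L (f i)
  | TApp s ts => TApp (fun i => term_rename f (ts i))
  end.

Fixpoint formula_rename V W (f : V -> W) (p : formula L V) : formula L W :=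
  match p with
  | FEq s t => FEq (term_rename f s) (term_rename f t)
  | FRel r ts => FRel (fun i => term_rename f (ts i))
  | FFalse => FFalse L W
  | FImp p q => FImp (formula_rename f p) (formula_rename f q)
  | FAll p => FAll (formula_rename (omap f) p)
  end.

Lemma teval_rename V W (f : V -> W) (v : W -> M) t :
  teval v (term_rename f t) = teval (v \o f) t.
Proof. by elim: t => //= s ts IH; congr finterp; apply/funext => i. Qed.

Lemma sat_rename V W (f : V -> W) (v : W -> M) p :
  sat v (formula_rename f p) <-> sat (v \o f) p.
Proof.
elim: p W f v => {V} [V s t|V r ts|V|V p IHp q IHq|V p IHp] W f v //=.
- by rewrite !teval_rename.
- rewrite (_ : (fun i => _) = fun i => teval (v \o f) (ts i)) //.
  by apply/funext => i; rewrite teval_rename.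
- by rewrite IHp IHq.
- by split=> H a; move: (H a); rewrite IHp;
    rewrite (_ : oapp v a \o omap f = oapp (v \o f) a) //; apply/funext => -[].
Qed.

End Renaming.

Section Definable.
Variables (L : language) (M : fo_structure L).
Implicit Types V W : Type.

Lemma definable_ext V (D D' : set (V -> M)) :
  (forall v, D v <-> D' v) -> definable D -> definable D'.
Proof. by move=> DD' dD; suff <- : D = D' by []; apply/seteqP; split=> v /DD'. Qed.

Lemma definable_comp V W (f : V -> W) (D : set (V -> M)) :
  definable D -> definable [set w : W -> M | D (w \o f)].
Proof.
move=> [m [phi [a ->]]].
pose r (s : V + 'I_m) : W + 'I_m :=
  match s with inl v => inl (f v) | inr i => inr i end.
exists m, (formula_rename r phi), a.
apply/seteqP; split=> w /=; rewrite /defset/= sat_rename;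
  by rewrite (_ : join _ _ \o _ = join (w \o f) a) //; apply/funext => -[].
Qed.

Lemma definable_imp V (D D' : set (V -> M)) :
  definable D -> definable D' -> definable [set v | D v -> D' v].
Proof.
move=> [m [phi [a ->]]] [m' [phi' [a' ->]]].
pose b (i : 'I_(m + m')) :=
  match fintype.split i with inl j => a j | inr j => a' j end.
pose l (s : V + 'I_m) : V + 'I_(m + m') :=
  match s with inl v => inl v | inr i => inr (lshift m' i) end.
pose r (s : V + 'I_m') : V + 'I_(m + m') :=
  match s with inl v => inl v | inr i => inr (rshift m i) end.
exists (m + m')%N, (FImp (formula_rename l phi) (formula_rename r phi')), b.
have lE v : join v b \o l = join v a.
  by apply/funext => -[//|i]; rewrite /b /= (unsplitK (inl i)).
have rE v : join v b \o r = join v a'.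
  by apply/funext => -[//|i]; rewrite /b /= (unsplitK (inr i)).
by apply/seteqP; split=> v; rewrite /defset /= !sat_rename lE rE.
Qed.

Lemma definable_false V : definable (fun _ : V -> M => False).
Proof.
have [x] := carrier_inhabited M.
by exists 0%N, (FFalse L _), (fun=> x).
Qed.

Lemma definable_forall V (D : set (option V -> M)) :
  definable D -> definable [set v : V -> M | forall a, D (oapp v a)].
Proof.
move=> [m [phi [a ->]]].
pose f (s : option V + 'I_m) : option (V + 'I_m) :=
  match s with inl v => omap inl v | inr i => Some (inr i) end.
exists m, (FAll (formula_rename f phi)), a.
have fE (v : V -> M) x : oapp (join v a) x \o f = join (oapp v x) a.
  by apply/funext => -[[]|].
apply/seteqP; split=> v H x.
  by apply/sat_rename; rewrite fE; exact: H.
by have /sat_rename := H x; rewrite fE.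
Qed.

Lemma definable_param V n (D : set (V + 'I_n -> M)) (b : 'I_n -> M) :
  definable D -> definable [set v | D (join v b)].
Proof.
move=> [m [phi [a ->]]].
pose ba (i : 'I_(n + m)) :=
  match fintype.split i with inl j => b j | inr j => a j end.
pose f (s : (V + 'I_n) + 'I_m) : V + 'I_(n + m) :=
  match s with
  | inl (inl v) => inl v | inl (inr i) => inr (lshift m i)
  | inr i => inr (rshift n i) end.
exists (n + m)%N, (formula_rename f phi), ba.
have fE v : join v ba \o f = join (join v b) a.
  apply/funext => -[[//|i]|i]; rewrite /ba /=.
    by rewrite (unsplitK (inl i)).
  by rewrite (unsplitK (inr i)).
by apply/seteqP; split=> v; rewrite /defset /= sat_rename fE.
Qed.

Lemma definable_var_eq V (i j : V) : definable [set v : V -> M | v i = v j].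
Proof.
have [x] := carrier_inhabited M.
by exists 0%N, (FEq (TVar L (inl i)) (TVar L (inl j))), (fun=> x).
Qed.

Lemma definable_not V (D : set (V -> M)) :
  definable D -> definable [set v | ~ D v].
Proof. by move=> dD; apply: definable_imp dD (definable_false V). Qed.

Lemma definable_and V (D D' : set (V -> M)) :
  definable D -> definable D' -> definable [set v | D v /\ D' v].
Proof.
move=> dD dD'; have := definable_not (definable_imp dD (definable_not dD')).
by apply: definable_ext => v /=; rewrite not_implyP notK.
Qed.

Lemma definable_exists1 V (D : set (option V -> M)) :
  definable D -> definable [set v : V -> M | exists a, D (oapp v a)].
Proof.
move=> /definable_not /definable_forall /definable_not.
by apply: definable_ext => v /=; rewrite -existsNE; split=> -[a] Da;
  exists a; rewrite /= ?notK in Da *.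
Qed.

Lemma definable_exists V n (D : set (V + 'I_n -> M)) :
  definable D -> definable [set v | exists a, D (join v a)].
Proof.
elim: n V D => [|n IH] V D dD.
  have [x] := carrier_inhabited M.
  apply: definable_ext (definable_param (fun=> x) dD) => v /=; split.
    by exists (fun=> x).
  by move=> [a]; rewrite (_ : a = fun=> x) //; apply/funext => -[].
(* Coordinate 0 of the quantified tuple becomes the variable [None]. The induction hypothesis over
   [option V] removes the other n coordinates, and a single quantifier removes [None]. *)
pose f (s : V + 'I_n.+1) : option V + 'I_n :=
  match s with
  | inl v => inl (Some v)
  | inr i => match unlift ord0 i with None => inl None | Some j => inr j end
  end.
have := definable_exists1 (IH _ _ (definable_comp f dD)).
apply: definable_ext => v /=; split=> [[x [a Da]]|[a Da]].
  pose b i := match unlift ord0 i with None => x | Some j => a j end.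
  exists b; suff -> : join v b = join (oapp v x) a \o f by [].
  by apply/funext => -[//|i] /=; rewrite /b; case: unliftP.
exists (a ord0), (fun i => a (lift ord0 i)).
set w := join _ _; suff -> : w \o f = join v a by [].
by apply/funext => -[//|i] /=; rewrite /w; case: unliftP => [j|] ->.
Qed.

Lemma definable_forall_ord V n (D : 'I_n -> set (V -> M)) :
  (forall i, definable (D i)) -> definable [set v | forall i, D i v].
Proof.
elim: n D => [|n IH] D dD.
  by apply: definable_ext (definable_not (definable_false V)) => v; split=> // _ [].
have := definable_and (dD ord0) (IH _ (fun i => dD (lift ord0 i))).
apply: definable_ext => v /=; split=> [[D0 D1] i|Dv]; last by split=> // i.
by case: (unliftP ord0 i) => [j|] ->.
Qed.

End Definable.

(* A type E with e : E -> (V -> M) is handled as a set of tuples of M, and a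
   predicate P on E is coded if it is the trace of a definable set of tuples;
   this is insensitive to the complement of the range of e, so that coded
   predicates are closed under connectives without relativization. *)
Section Coded.
Variables (L : language) (M : fo_structure L).
Implicit Types V W E F : Type.

Definition coded V E (e : E -> V -> M) (P : E -> Prop) :=
  exists2 D : set (V -> M), definable D & forall x, P x <-> D (e x).

Definition pair_code V W E F (e : E -> V -> M) (f : F -> W -> M) (p : E * F) :=
  join (e p.1) (f p.2).

Lemma coded_ext V E (e : E -> V -> M) P P' :
  (forall x, P x <-> P' x) -> coded e P -> coded e P'.
Proof. by move=> PP' [D dD PD]; exists D => // x; rewrite -PP'. Qed.

Lemma coded_comp V W E F (e : E -> V -> M) (f : F -> W -> M)
    (h : E -> F) (s : W -> V) P :
  (forall x, f (h x) = e x \o s) -> coded f P -> coded e (fun x => P (h x)).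
Proof.
move=> fh [D dD PD]; exists [set v : V -> M | D (v \o s)]; first exact: definable_comp.
by move=> x; rewrite PD fh.
Qed.

Lemma coded_fst V W E F (e : E -> V -> M) (f : F -> W -> M) P :
  coded e P -> coded (pair_code e f) (fun p => P p.1).
Proof. exact: (@coded_comp _ _ _ _ (pair_code e f) e fst inl). Qed.

Lemma coded_snd V W E F (e : E -> V -> M) (f : F -> W -> M) P :
  coded f P -> coded (pair_code e f) (fun p => P p.2).
Proof. exact: (@coded_comp _ _ _ _ (pair_code e f) f snd inr). Qed.

Lemma coded_not V E (e : E -> V -> M) P : coded e P -> coded e (fun x => ~ P x).
Proof.
move=> [D dD PD]; eexists; first exact: definable_not dD.
by move=> x /=; rewrite PD.
Qed.

Lemma coded_and V E (e : E -> V -> M) P P' :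
  coded e P -> coded e P' -> coded e (fun x => P x /\ P' x).
Proof.
move=> [D dD PD] [D' dD' PD']; eexists; first exact: definable_and dD dD'.
by move=> x /=; rewrite PD PD'.
Qed.

Lemma coded_true V E (e : E -> V -> M) : coded e (fun _ => True).
Proof.
by eexists; [exact: definable_not (definable_false _ _)|move=> x; split=> // _ []].
Qed.

Section Quantifiers.
Variables (W : Type) (n : nat) (F : Type) (f : F -> 'I_n -> M).
Hypothesis f_def : definable (range f).

Lemma coded_exists V E (e : E -> V -> M) (P : E -> F -> Prop) :
  coded (pair_code e f) (fun p => P p.1 p.2) -> coded e (fun x => exists y, P x y).
Proof.
move=> [D dD PD].
(* Here relativization is unavoidable: the quantifier must range over codes of elements of [F] only,
   whence the conjunct [range f]. *)
have := definable_exists (definable_and (definable_comp (@inr V 'I_n) f_def) dD).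
move=> dE; eexists; first exact: dE.
move=> x /=; split=> [[y Pxy]|[a [[y _ ya]] Da]].
  by exists (f y); split; [exists y|apply/(PD (x, y))].
by exists y; apply/(PD (x, y)); rewrite /pair_code /= ya.
Qed.

Lemma coded_forall V E (e : E -> V -> M) (P : E -> F -> Prop) :
  coded (pair_code e f) (fun p => P p.1 p.2) -> coded e (fun x => forall y, P x y).
Proof.
move=> /coded_not cP.
have := coded_not (@coded_exists _ _ e (fun x y => ~ P x y) cP).
apply: coded_ext => x; split=> [H y|H [y]]; last by apply.
by apply: contrapT => nP; apply: H; exists y.
Qed.

Lemma coded_param V E (e : E -> V -> M) (P : E -> F -> Prop) y :
  coded (pair_code e f) (fun p => P p.1 p.2) -> coded e (fun x => P x y).
Proof.
move=> [D dD PD]; eexists; first exact: (definable_param (f y) dD).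
by move=> x; exact: (PD (x, y)).
Qed.

Lemma definable_image P : coded f P -> definable (f @` [set x | P x]).
Proof.
move=> [D dD PD]; apply: definable_ext (definable_and f_def dD) => v /=; split.
  by move=> [[x _ <-]] /PD; exists x.
by move=> [x Px <-]; split; [exists x|apply/PD].
Qed.

Lemma coded_image P : injective f -> definable (f @` [set x | P x]) -> coded f P.
Proof.
move=> f_inj dP; exists (f @` [set x | P x]) => // x; split; first by exists x.
by case=> y /= Py /f_inj <-.
Qed.

Lemma coded_eq : injective f -> coded (pair_code f f) (fun p => p.1 = p.2).
Proof.
move=> f_inj; exists [set v | forall i : 'I_n, v (inl i) = v (inr i)].
  by apply: definable_forall_ord => i; exact: definable_var_eq.
move=> [x y] /=; split=> [->//|H]; apply: f_inj; apply/funext => i.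
exact: H.
Qed.

End Quantifiers.

Lemma definable_range_pair n m E F (e : E -> 'I_n -> M) (f : F -> 'I_m -> M) :
  definable (range e) -> definable (range f) -> definable (range (pair_code e f)).
Proof.
move=> de df.
have := definable_and (definable_comp (@inl 'I_n 'I_m) de)
                      (definable_comp (@inr 'I_n 'I_m) df).
apply: definable_ext => v /=; split=> [[[x _ xv] [y _ yv]]|[[x y] _ <-]].
  exists (x, y) => //; rewrite /pair_code /= xv yv.
  by apply/funext => -[].
by split; [exists x|exists y].
Qed.

Lemma definable_image_pair n m E F (e : E -> 'I_n -> M) (f : F -> 'I_m -> M) P :
  definable (range e) -> definable (range f) -> coded (pair_code e f) P ->
  definable (pair_code e f @` [set x | P x]).
Proof.
move=> de df [D dD PD].
apply: definable_ext (definable_and (definable_range_pair de df) dD) => v /=; split.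
  by move=> [[x _ <-]] /PD; exists x.
by move=> [x Px <-]; split; [exists x|apply/PD].
Qed.

(** [pair_code] indexed by an ordinal instead of a sum type, since [interpretable] and [dim] only
    accept tuples indexed by ['I_n]. *)
Definition ord_code n m E F (e : E -> 'I_n -> M) (f : F -> 'I_m -> M)
    (p : E * F) : 'I_(n + m) -> M := pair_code e f p \o @fintype.split n m.

Lemma pair_code_ord n m E F (e : E -> 'I_n -> M) (f : F -> 'I_m -> M) p :
  pair_code e f p = ord_code e f p \o @unsplit n m.
Proof. by apply/funext => s; rewrite /ord_code /= unsplitK. Qed.

Lemma ord_code_inj n m E F (e : E -> 'I_n -> M) (f : F -> 'I_m -> M) :
  injective e -> injective f -> injective (ord_code e f).
Proof.
move=> e_inj f_inj p q pq.
have {}pq : pair_code e f p = pair_code e f q by rewrite !pair_code_ord pq.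
case: p q pq => [x y] [x' y'] pq; congr (_, _).
- by apply: e_inj; apply/funext => i; have := congr1 (fun u => u (inl i)) pq.
- by apply: f_inj; apply/funext => i; have := congr1 (fun u => u (inr i)) pq.
Qed.

Lemma definable_range_ord n m E F (e : E -> 'I_n -> M) (f : F -> 'I_m -> M) :
  definable (range e) -> definable (range f) -> definable (range (ord_code e f)).
Proof.
move=> de df.
have := definable_comp (@unsplit n m) (definable_range_pair de df).
apply: definable_ext => v /=; split=> -[p _ pv]; exists p => //.
  by rewrite /ord_code pv; apply/funext => i /=; rewrite splitK.
by rewrite pair_code_ord pv.
Qed.

End Coded.

(** * Dimension of quotients and fibrations *)

Section Dimension.
Variables (L : language) (T : theory L).
Variable dim : forall (M : fo_structure L) n, set (set ('I_n -> M)) -> dimval.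
Hypothesis dimP : dimension_axioms T dim.
Variable M : fo_structure L.
Hypothesis MT : models M T.

Definition equiv_on E (P : set E) (R : E -> E -> Prop) :=
  [/\ forall x, P x -> R x x,
      forall x y, P x -> P y -> R x y -> R y x &
      forall x y z, P x -> P y -> P z -> R x y -> R y z -> R x z].

Definition quot_class n E (e : E -> 'I_n -> M) (P : set E) (R : E -> E -> Prop) x :=
  e @` [set y | P y /\ R x y].

(** The quotient P/R, with its classes written as sets of tuples so that [dim] applies to it. *)
Definition quot n E (e : E -> 'I_n -> M) (P : set E) (R : E -> E -> Prop) :=
  quot_class e P R @` P.

Definition coding n E (e : E -> 'I_n -> M) := injective e /\ definable (range e).

Definition coded_rel n E (e : E -> 'I_n -> M) (R : E -> E -> Prop) :=
  coded (pair_code e e) (fun p => R p.1 p.2).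

Lemma quot_class_eq n E (e : E -> 'I_n -> M) P R x y :
  injective e -> equiv_on P R -> P x -> P y ->
  quot_class e P R x = quot_class e P R y <-> R x y.
Proof.
move=> e_inj [Rr Rs Rt] Px Py; split=> [xy|Rxy].
  have: quot_class e P R y (e y) by exists y => //; split=> //; exact: Rr.
  by rewrite -xy => -[z [Pz Rxz] /e_inj <-].
by apply/seteqP; split=> _ [z [Pz Rz] <-]; exists z => //; split=> //;
  [apply: (Rt _ x) => //; exact: Rs|exact: (Rt _ y)].
Qed.

Lemma interpretable_quot n E (e : E -> 'I_n -> M) P R :
  coding e -> coded e P -> coded_rel e R -> equiv_on P R ->
  interpretable (quot e P R).
Proof.
move=> [e_inj de] cP cR [Rr Rs Rt].
have RE x y : (pair_code e e @` [set p | R p.1 p.2]) (join (e x) (e y)) <-> R x y.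
  split=> [[[x' y'] /= Rxy xy]|Rxy]; last by exists (x, y).
  have -> : x = x'.
    by apply/e_inj/funext => i; have := congr1 (fun u => u (inl i)) xy.
  have -> // : y = y'.
  by apply/e_inj/funext => i; have := congr1 (fun u => u (inr i)) xy.
exists (e @` P), (pair_code e e @` [set p | R p.1 p.2]); split.
- exact: definable_image.
- exact: definable_image_pair.
- split.
  + by move=> _ [x Px <-]; apply/RE; exact: Rr.
  + by move=> _ _ [x Px <-] [y Py <-] /RE xy; apply/RE; exact: Rs.
  + move=> _ _ _ [x Px <-] [y Py <-] [z Pz <-] /RE xy /RE yz; apply/RE.
    exact: (Rt _ y).
- rewrite /classes image_comp; apply: eq_imagel => x Px /=.
  apply/seteqP; split.
    by move=> _ [y [Py Rxy] <-]; split; [exists y|apply/RE].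
  by move=> _ [[y Py <-] /RE Rxy]; exists y.
Qed.

Section Fibration.
Variables (n m : nat) (E F : Type) (e : E -> 'I_n -> M) (f : F -> 'I_m -> M).
Hypotheses (ce : coding e) (cf : coding f).
Variables (P : set E) (R : E -> E -> Prop) (Q : set F) (S : F -> F -> Prop).
Variable phi : E -> F.
Hypotheses (cP : coded e P) (cR : coded_rel e R) (eR : equiv_on P R).
Hypotheses (cQ : coded f Q) (cS : coded_rel f S) (eS : equiv_on Q S).
Hypothesis phiPQ : forall x, P x -> Q (phi x).
Hypothesis phiRS : forall x y, P x -> P y -> R x y -> S (phi x) (phi y).
Hypothesis cphi : coded (pair_code e f) (fun p => S (phi p.1) p.2).

(** The map P/R -> Q/S induced by [phi]. Ranging over all points of the class avoids choosing
    representatives and keeps the graph definable. *)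
Let psi (C : set ('I_n -> M)) : set ('I_m -> M) :=
  f @` [set y | Q y /\ exists x, [/\ P x, C (e x) & S (phi x) y]].

Let psiE x : P x -> psi (quot_class e P R x) = quot_class f Q S (phi x).
Proof.
move=> Px; have [Rr Rs Rt] := eR; have [Sr Ss St] := eS.
apply/seteqP; split=> _ [y [Qy Sy] <-]; exists y => //; split=> //.
  case: Sy => z [Pz [z' [Pz' Rxz'] /ce.1 z'z] Szy].
  by subst z'; apply: (St _ (phi z)); auto.
by exists x; split=> //; exists x => //; split=> //; exact: Rr.
Qed.

Let psi_fun : interpretable_fun (quot e P R) (quot f Q S) psi.
Proof.
split=> [_ [x Px <-]|]; first by rewrite psiE //; exists (phi x) => //; exact: phiPQ.
have := definable_image_pair ce.2 cf.2 (coded_and (coded_and _ _) cphi).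
move=> /(_ (fun p => P p.1) (fun p => Q p.2)) H.
have {}H := H (coded_fst f cP) (coded_snd e cQ).
apply: definable_ext H => v; split.
  move=> [[x y] /= [[Px Qy] Sxy] <-]; exists (e x), (f y); split=> //.
  exists (quot_class e P R x); first by exists x.
  split; first by exists x => //; split=> //; case: eR => + _ _; apply.
  by rewrite psiE //; exists y.
move=> [u [w [-> [C [x Px <-] [[x' [Px' Rx'] <-]]]]]].
rewrite psiE // => -[y [Qy Sy] <-]; exists (x', y) => //=; split=> //.
have [Rr Rs Rt] := eR; have [Sr Ss St] := eS.
by apply: (St _ (phi x)); auto.
Qed.

(** By [phiRS], the set of the x with [S (phi x) y] is a union of R-classes in P. Restricting P to
    it therefore leaves these classes unchanged, and the fibre is itself a quotient. *)
Let fibre y : Q y -> quot e P R `&` psi @^-1` [set quot_class f Q S y] =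
  quot e (fun x => P x /\ S (phi x) y) R.
Proof.
have [Sr Ss St] := eS => Qy.
have E1 x : P x -> S (phi x) y -> quot_class e P R x =
    quot_class e (fun x => P x /\ S (phi x) y) R x.
  move=> Px Sx; apply/seteqP; split=> u [z]; last by move=> [[Pz _] Rz] <-; exists z.
  move=> [Pz Rz] <-; exists z => //; split=> //; split=> //.
  apply: (St _ (phi x)); [exact: phiPQ|exact: phiPQ|by []| |by []].
  by apply: Ss; [exact: phiPQ|exact: phiPQ|exact: phiRS].
apply/seteqP; split.
  move=> _ [[x Px <-] /=]; rewrite psiE // => /quot_class_eq Sx.
  have {}Sx : S (phi x) y by apply: Sx => //; [exact: cf.1|exact: phiPQ].
  by exists x => //; rewrite E1.
move=> _ [x [Px Sx] <-]; rewrite -E1 //; split; first by exists x.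
by rewrite /preimage /= psiE // (quot_class_eq cf.1 eS) //; exact: phiPQ.
Qed.

Lemma dim_quot_ge k :
  (forall y, Q y ->
    dimval_le (Some k) (dim (quot e (fun x => P x /\ S (phi x) y) R))) ->
  dimval_le (dimval_add (dim (quot f Q S)) k) (dim (quot e P R)).
Proof.
move=> H; apply: (dim_fibre_ge dimP MT (f := psi)) => //.
- exact: interpretable_quot.
- exact: interpretable_quot.
- by move=> _ [y Qy <-]; rewrite fibre //; exact: H.
Qed.

Lemma dim_quot_le k :
  (forall y, Q y ->
    dimval_le (dim (quot e (fun x => P x /\ S (phi x) y) R)) (Some k)) ->
  dimval_le (dim (quot e P R)) (dimval_add (dim (quot f Q S)) k).
Proof.
move=> H; apply: (dim_fibre_le dimP MT (f := psi)) => //.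
- exact: interpretable_quot.
- exact: interpretable_quot.
- by move=> _ [y Qy <-]; rewrite fibre //; exact: H.
Qed.

End Fibration.

(** A definable set is viewed as interpretable through its singletons. *)
Definition dimset n E (e : E -> 'I_n -> M) (P : set E) := dim (quot e P eq).

Lemma equiv_on_eq E (P : set E) : equiv_on P eq.
Proof. by split=> // x y z _ _ _ -> ->. Qed.

Lemma coded_rel_eq n E (e : E -> 'I_n -> M) : coding e -> coded_rel e eq.
Proof. by move=> [e_inj _]; exact: coded_eq. Qed.

Lemma dimset0 n E (e : E -> 'I_n -> M) (P : set E) :
  (forall x, ~ P x) -> dimset e P = None.
Proof.
move=> nP; rewrite /dimset (_ : quot _ _ _ = set0) ?(dim_empty dimP)//.
by apply/seteqP; split=> // C [x /nP].
Qed.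

Lemma dimset1 n E (e : E -> 'I_n -> M) (P : set E) x :
  coding e -> coded e P -> P x -> (forall y, P y -> y = x) ->
  dimset e P = Some 0%N.
Proof.
move=> ce cP Px P1; apply/(dim_finite dimP MT).
  exact/interpretable_quot/equiv_on_eq/coded_rel_eq.
rewrite (_ : quot _ _ _ = [set quot_class e P eq x]).
  by split; [exact: finite_set1|exists (quot_class e P eq x)].
apply/seteqP; split=> [_ [y Py <-]|_ ->]; last by exists x.
by rewrite (P1 y).
Qed.

Lemma dimset_subsingleton n E (e : E -> 'I_n -> M) (P : set E) :
  coding e -> coded e P -> (forall x y, P x -> P y -> x = y) ->
  dimval_le (dimset e P) (Some 0%N).
Proof.
move=> ce cP P1; have [[x Px]|nP] := pselect (exists x, P x); last first.
  by rewrite dimset0 // => x Px; apply: nP; exists x.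
by rewrite (dimset1 ce cP Px) // => y Py; exact: P1.
Qed.

Lemma dimval_le_trans a b k :
  dimval_le a b -> dimval_le b k -> dimval_le a k.
Proof. by case: a b k => [i|] [j|] [k|] //=; exact: leq_trans. Qed.

Lemma dimval_add0 a : dimval_add a 0 = a.
Proof. by case: a => //= k; rewrite addn0. Qed.

(** The fibres have at most one point, hence dimension at most 0, and the upper fibre axiom applies
    with k = 0. *)
Lemma dimset_inj n m E F (e : E -> 'I_n -> M) (f : F -> 'I_m -> M)
    (P : set E) (Q : set F) (phi : E -> F) :
  coding e -> coding f -> coded e P -> coded f Q ->
  coded (pair_code e f) (fun p => phi p.1 = p.2) ->
  (forall x, P x -> Q (phi x)) ->
  (forall x y, P x -> P y -> phi x = phi y -> x = y) ->
  dimval_le (dimset e P) (dimset f Q).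
Proof.
move=> ce cf cP cQ cphi PQ phi_inj; rewrite -[dimset f Q]dimval_add0.
apply: (dim_quot_le ce cf (phi := phi)) => //.
- exact: coded_rel_eq.
- exact: equiv_on_eq.
- exact: coded_rel_eq.
- exact: equiv_on_eq.
- by move=> x y _ _ ->.
move=> y Qy; apply: dimset_subsingleton => //.
  by apply: coded_and cP _; exact: (coded_param (P := fun x y => phi x = y) y cphi).
by move=> x x' [Px xy] [Px' x'y]; apply: phi_inj => //; rewrite xy x'y.
Qed.

Lemma dimset_sub n E (e : E -> 'I_n -> M) (P Q : set E) :
  coding e -> coded e P -> coded e Q -> P `<=` Q ->
  dimval_le (dimset e P) (dimset e Q).
Proof.
move=> ce cP cQ PQ; apply: (dimset_inj (phi := id)) => //.
exact: coded_rel_eq.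
Qed.

Lemma dimset_Some n E (e : E -> 'I_n -> M) (P : set E) x :
  coding e -> coded e P -> P x -> exists k, dimset e P = Some k.
Proof.
move=> ce cP Px.
have c1 : coded e (eq^~ x) by exact: (coded_param (P := eq) x (coded_rel_eq ce)).
have := dimset_sub ce c1 cP (fun y (yx : y = x) => eq_ind_r P Px yx).
rewrite (dimset1 ce c1 (erefl x)) //.
by case: (dimset e P) => // k _; exists k.
Qed.

Lemma dimset_setU n E (e : E -> 'I_n -> M) (P Q : set E) :
  coding e -> coded e P -> coded e Q ->
  dimset e (P `|` Q) = dimval_max (dimset e P) (dimset e Q).
Proof.
move=> ce cP cQ.
have cPQ : coded e (P `|` Q).
  apply: coded_ext (coded_not (coded_and (coded_not cP) (coded_not cQ))) => x /=.
  by rewrite not_andP !notK.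
(* The classes of equality are singletons and do not depend on the ambient set, so forming the
   quotient commutes with unions. *)
have E1 (X : set E) : quot e X eq = (fun x => [set e x]) @` X.
  apply: eq_imagel => x Xx; apply/seteqP; split=> [_ [y [_ <-] <-]|_ ->] //.
  by exists x.
have I X : coded e X -> interpretable (quot e X eq).
  by move=> cX; exact/interpretable_quot/equiv_on_eq/coded_rel_eq.
have U : quot e (P `|` Q) eq = quot e P eq `|` quot e Q eq.
  by rewrite !E1 image_setU.
by rewrite /dimset U (dim_union dimP MT) // -?U; exact: I.
Qed.

End Dimension.

(** * Finite index *)

Section ZmodClosedOfSubgroup.
Variables (G : zmodType) (H : set G).

Definition subgroup := H 0 /\ forall x y, H x -> H y -> H (x - y).

(** The proof is an argument so that the [zmodClosed] structure can be attached to the predicate;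
    [ideal_pred] below is built in the same way. *)
Definition subgroup_pred of subgroup : G -> bool := fun x => `[< H x >].

Variable sH : subgroup.

Fact subgroup_pred_closed : zmod_closed (subgroup_pred sH).
Proof.
split=> [|x y /asboolP Hx /asboolP Hy]; apply/asboolP; first by case: sH.
by case: sH => _; apply.
Qed.

HB.instance Definition _ := GRing.isZmodClosed.Build G (subgroup_pred sH)
  subgroup_pred_closed.

End ZmodClosedOfSubgroup.

Section LieIdealOfSet.
Variables (G : lieRingType) (I : set G).

Definition lie_stable := forall x y, I y -> I (lie x y).

Variables (sI : subgroup I) (iI : lie_stable).

Definition ideal_pred of lie_stable : G -> bool := subgroup_pred sI.

HB.instance Definition _ := GRing.isZmodClosed.Build G (ideal_pred iI)
  (subgroup_pred_closed sI).

Fact ideal_pred_closed x y : y \in ideal_pred iI -> lie x y \in ideal_pred iI.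
Proof. by move=> /asboolP Iy; apply/asboolP; exact: iI. Qed.

HB.instance Definition _ := isLieClosed.Build G (ideal_pred iI) ideal_pred_closed.

End LieIdealOfSet.

Lemma exists_lieIdeal (G : lieRingType) (I : set G) :
  subgroup I -> lie_stable I -> exists J : lieIdeal G, [set` J] = I.
Proof.
move=> sI iI; exists (LieIdeal.clone G (ideal_pred sI iI) _).
by apply/seteqP; split=> x; [move=> /asboolP|move=> Ix; apply/asboolP].
Qed.

Lemma exists_zmodClosed (G : zmodType) (H : set G) :
  subgroup H -> exists K : zmodClosed G, [set` K] = H.
Proof.
move=> sH; exists (GRing.ZmodClosed.clone G (subgroup_pred sH) _).
by apply/seteqP; split=> x; [move=> /asboolP|move=> Hx; apply/asboolP].
Qed.

Section AlmostContained.
Variable G : zmodType.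
Implicit Types H K J A B : set G.

(** For subgroups this says that the intersection of K and H has finite index in K. The translates
    are given by a list of points of [G], with no inclusion required between K and H, which makes
    the relation transitive. *)
Definition almost_sub K H :=
  exists s : seq G, forall x, K x -> exists2 a, a \in s & H (x - a).

Lemma subgroupN H x : subgroup H -> H x -> H (- x).
Proof. by move=> [H0 HB] Hx; rewrite -sub0r; exact: HB. Qed.

Lemma subgroupD H x y : subgroup H -> H x -> H y -> H (x + y).
Proof. by move=> sH Hx Hy; rewrite -[y]opprK; apply: sH.2 => //; exact: subgroupN. Qed.

Lemma almost_sub_sub K H : K `<=` H -> almost_sub K H.
Proof.
by move=> KH; exists [:: 0] => x /KH Hx; exists 0; rewrite ?subr0 ?mem_head.
Qed.

Lemma almost_sub_trans K H J : almost_sub K H -> almost_sub H J -> almost_sub K J.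
Proof.
move=> [s sP] [t tP]; exists [seq a + b | a <- s, b <- t] => x /sP[a sa /tP[b tb Jx]].
by exists (a + b); [exact: allpairs_f|rewrite opprD addrA].
Qed.

Lemma almost_subr K H J : almost_sub K H -> H `<=` J -> almost_sub K J.
Proof. by move=> KH /almost_sub_sub; exact: almost_sub_trans. Qed.

Lemma almost_subl K H J : K `<=` H -> almost_sub H J -> almost_sub K J.
Proof. by move=> /almost_sub_sub; exact: almost_sub_trans. Qed.

(** Pigeonhole: [r] labels the points of K by finitely many labels, and one point of K kept for each
    label that occurs gives the list of translates. *)
Lemma almost_sub_finite (T : eqType) (s : seq T) (r : G -> T -> Prop) K H :
  (forall x, K x -> exists2 i, i \in s & r x i) ->
  (forall x y i, K x -> K y -> r x i -> r y i -> H (x - y)) -> almost_sub K H.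
Proof.
elim: s K => [|i s IH] K Ks Kr; first by exists [::] => x /Ks [].
have [|t tP] := IH [set x | K x /\ exists2 j, j \in s & r x j] (fun x => @proj2 _ _).
  by move=> x y j [Kx _] [Ky _]; exact: Kr.
have [[x0 [Kx0 x0i]]|nx] := pselect (exists x, K x /\ r x i); last first.
  exists t => x Kx; apply: tP; split=> //; have [j] := Ks _ Kx.
  by rewrite inE => /orP[/eqP -> xi|sj xj]; [case: nx; exists x|exists j].
exists (x0 :: t) => x Kx; have [j] := Ks _ Kx.
rewrite inE => /orP[/eqP -> xi|sj xj].
  by exists x0; [exact: mem_head|exact: (Kr _ _ i)].
have [|a ta Ha] := tP x; first by split=> //; exists j.
by exists a => //; rewrite inE ta orbT.
Qed.

Lemma almost_sub_finite_set (T : Type) (f : G -> T) K H : subgroup H ->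
  (forall x y, K x -> K y -> f x = f y <-> H (x - y)) ->
  finite_set (f @` K) <-> almost_sub K H.
Proof.
elim/Pchoice: T => T in f *; move=> sH fE; split.
  move=> /finite_seqP[s fKs].
  apply: (@almost_sub_finite T s (fun x i => f x = i)).
    move=> x Kx; exists (f x) => //.
    by have := imageP f Kx; rewrite fKs.
  by move=> x y i Kx Ky xi yi; apply/fE => //; rewrite xi yi.
move=> [s sP].
(* A point of K is chosen in each translate a + H. If K misses the translate the default 0 is
   returned, which only adds a harmless value to a finite set. *)
pose F a := f (xget 0 [set x | K x /\ H (x - a)]).
have fs : finite_set [set` s] by apply/finite_seqP; exists s.
apply: sub_finite_set (finite_image F fs) => _ [x Kx <-].
have [a sa Ha] := sP x Kx; exists a => //; rewrite /F.
case: xgetP => [y _ [Ky Hy]|/(_ x)]; last by case.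
by apply/fE => //; have := sH.2 _ _ Hy Ha; rewrite opprB addrA subrK.
Qed.

Lemma almost_subI K H J : subgroup H -> subgroup J ->
  almost_sub K H -> almost_sub K J -> almost_sub K (H `&` J).
Proof.
move=> sH sJ [s sP] [t tP].
apply: (@almost_sub_finite _ [seq (a, b) | a <- s, b <- t]
  (fun x i => H (x - i.1) /\ J (x - i.2))) => [x Kx|x y [a b] _ _ [/= Hx Jx] [Hy Jy]].
  have [a sa Ha] := sP x Kx; have [b tb Jb] := tP x Kx.
  by exists (a, b) => //; exact: allpairs_f.
split; first by have := sH.2 _ _ Hx Hy; rewrite opprB addrA subrK.
by have := sJ.2 _ _ Jx Jy; rewrite opprB addrA subrK.
Qed.

Lemma almost_sub_image (f : G -> G) K H : {morph f : x y / x - y} ->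
  almost_sub K H -> almost_sub (f @` K) (f @` H).
Proof.
move=> fB [s sP]; exists (map f s) => _ [x /sP[a sa Ha] <-].
by exists (f a); [exact: map_f|rewrite -fB; exists (x - a)].
Qed.

Lemma almost_sub_preimage (f : G -> G) K H : {morph f : x y / x - y} ->
  subgroup H -> almost_sub (f @` K) H -> almost_sub K (f @^-1` H).
Proof.
move=> fB sH [s sP]; apply: (@almost_sub_finite _ s (fun x i => H (f x - i))).
  by move=> x Kx; apply: sP; exists x.
move=> x y a _ _ Hx Hy; rewrite /preimage /= fB.
by have := sH.2 _ _ Hx Hy; rewrite opprB addrA subrK.
Qed.

Definition sumset A B : set G := [set x + y | x in A & y in B].

Lemma subgroup_sumset A B : subgroup A -> subgroup B -> subgroup (sumset A B).
Proof.
move=> sA sB; split.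
  by exists 0; [exact: sA.1|exists 0; [exact: sB.1|rewrite addr0]].
move=> _ _ [a Aa [b Bb <-]] [a' Aa' [b' Bb' <-]].
exists (a - a'); first exact: sA.2.
by exists (b - b'); [exact: sB.2|rewrite addrACA -opprD].
Qed.

Lemma sumset_subl A B : subgroup B -> A `<=` sumset A B.
Proof. by move=> [B0 _] x Ax; exists x => //; exists 0; rewrite ?addr0. Qed.

Lemma sumset_subr A B : subgroup A -> B `<=` sumset A B.
Proof. by move=> [A0 _] x Bx; exists 0 => //; exists x; rewrite ?add0r. Qed.

Lemma sumset_sub A B H : subgroup H -> A `<=` H -> B `<=` H -> sumset A B `<=` H.
Proof.
by move=> sH AH BH _ [a /AH Ha [b /BH Hb <-]]; exact: subgroupD.
Qed.

Lemma almost_sub_sumset A B H : subgroup H ->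
  almost_sub A H -> almost_sub B H -> almost_sub (sumset A B) H.
Proof.
move=> sH [s sP] [t tP]; exists [seq a + b | a <- s, b <- t].
move=> _ [x /sP[a sa Ha] [y /tP[b tb Hb] <-]].
exists (a + b); first exact: allpairs_f.
by rewrite opprD addrACA; exact: subgroupD.
Qed.

End AlmostContained.

(** * Definable subgroups of a definable Lie ring, connectedness and rank *)

Section DefinableSubgroups.
Variables (L : language) (T : theory L).
Variable dim : forall (M : fo_structure L) n, set (set ('I_n -> M)) -> dimval.
Hypothesis dimP : dimension_axioms T dim.
Variable M : fo_structure L.
Hypothesis MT : models M T.
Variables (g : lieRingType) (d : nat) (c : g -> 'I_d -> M).
Hypothesis gP : definable_lie_ring c.

Let cc : coding c. Proof. by case: gP. Qed.

Definition coded_fun V E (e : E -> V -> M) (t : E -> g) :=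
  coded (pair_code e c) (fun p => t p.1 = p.2).

(** The value of [t] is quantified: some y satisfies both t x = y and Q x y. Definability of all
    compound terms below reduces to this. *)
Lemma coded_subst V E (e : E -> V -> M) (t : E -> g) (Q : E -> g -> Prop) :
  coded_fun e t -> coded (pair_code e c) (fun p => Q p.1 p.2) ->
  coded e (fun x => Q x (t x)).
Proof.
move=> ct cQ.
have := coded_exists cc.2 (P := fun x y => t x = y /\ Q x y) (coded_and ct cQ).
by apply: coded_ext => x; split=> [[y [-> //]]|Qx]; exists (t x).
Qed.

Lemma coded_app V E (e : E -> V -> M) (t : E -> g) (S : set g) :
  coded c S -> coded_fun e t -> coded e (fun x => S (t x)).
Proof.
by move=> cS ct; apply: (coded_subst (Q := fun _ y => S y) ct); exact: coded_snd.
Qed.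

Lemma coded_fun_fst V W E F (e : E -> V -> M) (f : F -> W -> M) t :
  coded_fun e t -> coded_fun (pair_code e f) (fun p => t p.1).
Proof.
pose s (i : V + 'I_d) : (V + W) + 'I_d :=
  match i with inl v => inl (inl v) | inr j => inr j end.
apply: (coded_comp (h := fun p => (p.1.1, p.2)) (s := s)) => p.
by apply/funext => -[].
Qed.

Lemma coded_fun_comp V W E F (e : E -> V -> M) (f : F -> W -> M)
    (h : E -> F) (s : W -> V) t :
  (forall x, f (h x) = e x \o s) -> coded_fun f t -> coded_fun e (t \o h).
Proof.
move=> fh; pose s' (i : W + 'I_d) : V + 'I_d :=
  match i with inl v => inl (s v) | inr j => inr j end.
apply: (coded_comp (h := fun p => (h p.1, p.2)) (s := s')) => p.
by apply/funext => -[] //= i; rewrite fh.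
Qed.

Lemma coded_fun_id : coded_fun c id.
Proof. exact: coded_rel_eq. Qed.

Lemma coded_fun_snd V E (e : E -> V -> M) : coded_fun (pair_code e c) snd.
Proof. exact: (coded_fun_comp (h := snd) (s := inr) _ coded_fun_id). Qed.

Lemma coded_fun_const V E (e : E -> V -> M) a : coded_fun e (fun=> a).
Proof.
have H : coded c (eq a).
  apply: coded_ext (coded_param (P := eq) a (coded_rel_eq cc)) => x.
  by split=> ->.
exact: (coded_snd e H).
Qed.

Lemma coded_fun_op (op : g -> g -> g) V E (e : E -> V -> M) t u :
  definable [set v | exists x y, v = join (join (c x) (c y)) (c (op x y))] ->
  coded_fun e t -> coded_fun e u -> coded_fun e (fun x => op (t x) (u x)).
Proof.
move=> dop ct cu.
have cop : coded (pair_code (pair_code c c) c) (fun p => op p.1.1 p.1.2 = p.2).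
  exists [set v | exists x y, v = join (join (c x) (c y)) (c (op x y))] => //.
  move=> [[x y] z] /=; split=> [<-|[x' [y' H]]]; first by exists x, y.
  have -> : x = x'.
    by apply/cc.1/funext => i; exact: (congr1 (fun w => w (inl (inl i))) H).
  have -> : y = y'.
    by apply/cc.1/funext => i; exact: (congr1 (fun w => w (inl (inr i))) H).
  by apply/cc.1/funext => i; exact/esym/(congr1 (fun w => w (inr i)) H).
rewrite /coded_fun.
apply: (coded_subst (Q := fun p y => op y (u p.1) = p.2)); first exact: coded_fun_fst.
apply: (coded_subst (Q := fun q z => op q.2 z = q.1.2)).
  exact: (coded_fun_fst c (coded_fun_fst c cu)).
(* A point is now (((x, z), y), y'), with y and y' the values of the two arguments and z that of the
   operation; [s] picks out the triple (y, y', z). *)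
pose s (i : ('I_d + 'I_d) + 'I_d) : ((V + 'I_d) + 'I_d) + 'I_d :=
  match i with
  | inl (inl j) => inl (inr j) | inl (inr j) => inr j | inr j => inl (inl (inr j))
  end.
apply: (coded_comp (h := fun q => ((q.1.2, q.2), q.1.1.2)) (s := s) _ cop) => q.
by apply/funext => -[[]|].
Qed.

Lemma coded_funD V E (e : E -> V -> M) t u :
  coded_fun e t -> coded_fun e u -> coded_fun e (fun x => t x + u x).
Proof. by apply: (@coded_fun_op +%R); case: gP. Qed.

Lemma coded_fun_lie V E (e : E -> V -> M) t u :
  coded_fun e t -> coded_fun e u -> coded_fun e (fun x => lie (t x) (u x)).
Proof. by apply: (@coded_fun_op (@lie g)); case: gP. Qed.

Lemma coded_funN V E (e : E -> V -> M) t :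
  coded_fun e t -> coded_fun e (fun x => - t x).
Proof.
move=> ct.
have c0 : coded c [set 0].
  exact: (coded_param (P := eq) 0 (coded_rel_eq cc)).
apply: coded_ext (coded_app c0 (coded_funD (coded_fun_fst c ct) (coded_fun_snd e))).
move=> p /=; rewrite addrC; split=> [/eqP|<-]; last by rewrite addNr.
by rewrite addr_eq0 => /eqP ->.
Qed.

Lemma coded_funB V E (e : E -> V -> M) t u :
  coded_fun e t -> coded_fun e u -> coded_fun e (fun x => t x - u x).
Proof. by move=> ct /coded_funN; exact: coded_funD. Qed.

Lemma coded_fun_eq V E (e : E -> V -> M) t u :
  coded_fun e t -> coded_fun e u -> coded e (fun x => t x = u x).
Proof.
move=> ct cu; apply: (coded_subst (Q := fun x y => y = u x)) => //.
by apply: coded_ext cu => p; split=> ->.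
Qed.

Definition def_subgroup (H : set g) := subgroup H /\ coded c H.

Lemma lieBr (x y z : g) : lie x (y - z) = lie x y - lie x z.
Proof.
have lie0 : lie x 0 = 0 by apply: (addrI (lie x 0)); rewrite -lieDr !addr0.
rewrite lieDr; congr (_ + _).
by apply: (addrI (lie x z)); rewrite -lieDr !subrr.
Qed.

Lemma lier0 (x : g) : lie x 0 = 0.
Proof. by rewrite -[X in lie x X](subrr 0) lieBr subrr. Qed.

Lemma lieBl (x y z : g) : lie (x - y) z = lie x z - lie y z.
Proof. by rewrite lieC lieBr (lieC z x) (lieC z y) opprK opprD opprK. Qed.

Lemma def_subgroupI H K : def_subgroup H -> def_subgroup K -> def_subgroup (H `&` K).
Proof.
move=> [sH cH] [sK cK]; split; last exact: coded_and.
split; first by split; [exact: sH.1|exact: sK.1].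
by move=> x y [Hx Kx] [Hy Ky]; split; [exact: sH.2|exact: sK.2].
Qed.

Lemma def_subgroup_setT : def_subgroup setT.
Proof. by split=> //; exact: coded_true. Qed.

Lemma def_subgroup0 : def_subgroup [set 0].
Proof.
split; first by split=> // x y -> ->; rewrite subrr.
exact: (coded_param (P := eq) 0 (coded_rel_eq cc)).
Qed.

Lemma def_subgroup_sumset H K :
  def_subgroup H -> def_subgroup K -> def_subgroup (sumset H K).
Proof.
move=> [sH cH] [sK cK]; split; first exact: subgroup_sumset.
have : coded c (fun x => exists y, H y /\ K (x - y)).
  apply: coded_exists; first exact: cc.2.
  apply: coded_and; apply: coded_app => //; first exact: coded_fun_snd.
  apply: coded_funB; last exact: coded_fun_snd.
  exact: (coded_fun_fst c coded_fun_id).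
apply: coded_ext => x; split=> [[y [Hy Kxy]]|[y Hy [z Kz <-]]].
  by exists y => //; exists (x - y); rewrite // addrC subrK.
by exists y; rewrite addrAC subrr add0r.
Qed.

Lemma def_subgroup_preimage x H : def_subgroup H -> def_subgroup (lie x @^-1` H).
Proof.
move=> [sH cH]; split.
  split; first by rewrite /preimage /= lier0; exact: sH.1.
  by move=> y z Hy Hz; rewrite /preimage /= lieBr; exact: sH.2.
apply: coded_app => //.
by apply: coded_fun_lie; [exact: coded_fun_const|exact: coded_fun_id].
Qed.

Lemma def_subgroup_image x H : def_subgroup H -> def_subgroup (lie x @` H).
Proof.
move=> [sH cH]; split.
  split; first by exists 0; [exact: sH.1|rewrite lier0].
  by move=> _ _ [y Hy <-] [z Hz <-]; exists (y - z); [exact: sH.2|rewrite lieBr].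
have : coded c (fun y => exists z, H z /\ lie x z = y).
  apply: coded_exists; first exact: cc.2.
  apply: coded_and; first by apply: coded_app => //; exact: coded_fun_snd.
  apply: coded_fun_eq.
    by apply: coded_fun_lie; [exact: coded_fun_const|exact: coded_fun_snd].
  exact: (coded_fun_fst c coded_fun_id).
by apply: coded_ext => y; split=> [[z []]|[z]]; exists z.
Qed.

Lemma def_subgroup_annihilator H : def_subgroup H ->
  def_subgroup [set y | forall x, H (lie x y)].
Proof.
move=> [sH cH]; split.
  split; first by move=> x; rewrite lier0; exact: sH.1.
  by move=> y z Hy Hz x; rewrite lieBr; exact: sH.2.
apply: coded_forall; first exact: cc.2.
apply: coded_app => //; apply: coded_fun_lie; first exact: coded_fun_snd.
exact: (coded_fun_fst c coded_fun_id).
Qed.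

(** The usual connectedness, tested on the traces on H of definable subgroups K of [g]. As K need
    not lie in H, the notion passes at once to images and sums. *)
Definition connected H := forall K, def_subgroup K -> almost_sub H K -> H `<=` K.

Lemma connected_image x H : connected H -> connected (lie x @` H).
Proof.
move=> cH K dK /almost_sub_preimage HK _ [y Hy <-].
apply: (cH _ (def_subgroup_preimage x dK)) => //.
by apply: HK; [move=> *; exact: lieBr|case: dK].
Qed.

Lemma connected_sumset H K : subgroup H -> subgroup K ->
  connected H -> connected K -> connected (sumset H K).
Proof.
move=> sH sK cH cK J dJ HKJ; apply: sumset_sub; first by case: dJ.
  by apply: cH => //; apply: almost_subl HKJ; exact: sumset_subl.
by apply: cK => //; apply: almost_subl HKJ; exact: sumset_subr.
Qed.

(** The default 0 stands for the dimension of the empty set; for a subgroup, which contains 0, the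
    rank is the true dimension. *)
Definition rk (H : set g) := odflt 0%N (dimset dim c H).

Lemma dim_rk H x : coded c H -> H x -> dimset dim c H = Some (rk H).
Proof. by move=> cH Hx; rewrite /rk; have [k ->] := dimset_Some dimP MT cc cH Hx. Qed.

Section Index.
Variables H K : set g.
Hypotheses (dH : def_subgroup H) (dK : def_subgroup K) (HK : H `<=` K).

Let R (x y : g) := H (x - y).

Let eR : equiv_on K R.
Proof.
have [sH _] := dH; split=> [x _|x y _ _ Rxy|x y z _ _ _ Rxy Ryz].
- by rewrite /R subrr; exact: sH.1.
- by rewrite /R -opprB; exact: subgroupN.
- by rewrite /R -(subrK y x) -addrA; exact: subgroupD.
Qed.

Let cR : coded_rel c R.
Proof.
rewrite /coded_rel /R; apply: (coded_app (S := H)); first by case: dH.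
by apply: coded_funB; [exact: (coded_fun_fst c coded_fun_id)|exact: coded_fun_snd].
Qed.

Let coset y := fun x => K x /\ R x y.

Let ccoset y : coded c (coset y).
Proof.
apply: coded_and; first by case: dK.
exact: (coded_param (P := R) y cR).
Qed.

Let dim_coset_le y : dimval_le (dimset dim c (coset y)) (Some (rk H)).
Proof.
rewrite -(@dim_rk H 0); [|by case: dH|by case: dH => -[]].
apply: (dimset_inj dimP MT (phi := fun x => x - y)) => //.
- by case: dH.
- exact: (coded_funB coded_fun_id (coded_fun_const c y)).
- by move=> x [].
- by move=> x x' _ _ /addIr.
Qed.

Let dim_coset_ge y : K y -> dimval_le (Some (rk H)) (dimset dim c (coset y)).
Proof.
move=> Ky.
rewrite -(@dim_rk H 0); [|by case: dH|by case: dH => -[]].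
apply: (dimset_inj dimP MT (phi := fun x => x + y)) => //.
- by case: dH.
- exact: (coded_funD coded_fun_id (coded_fun_const c y)).
- move=> x Hx; split; first by apply: subgroupD => //; [case: dK|exact: HK].
  by rewrite /R addrK.
- by move=> x x' _ _ /addIr.
Qed.

Let cK : coded c K. Proof. by case: dK. Qed.
Let K0 : K 0. Proof. by case: dK => -[]. Qed.
Let cphi : coded (pair_code c c) (fun p => R (id p.1) p.2). Proof. exact: cR. Qed.

Let eqR x y : K x -> K y -> x = y -> R x y.
Proof. by move=> Kx _ <-; case: eR => + _ _; apply. Qed.

Let dim_le : dimval_le (Some (rk K)) (dimval_add (dim (quot c K R)) (rk H)).
Proof.
rewrite -(dim_rk cK K0).
apply: (dim_quot_le dimP MT cc cc (phi := id) cK (coded_rel_eq cc)) => //.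
  exact: equiv_on_eq.
by move=> y _; exact: dim_coset_le.
Qed.

Let dim_ge : dimval_le (dimval_add (dim (quot c K R)) (rk H)) (Some (rk K)).
Proof.
rewrite -(dim_rk cK K0).
apply: (dim_quot_ge dimP MT cc cc (phi := id) cK (coded_rel_eq cc)) => //.
exact: equiv_on_eq.
Qed.

(** Cosets of H in K are translates of H, so the fibre axioms give rk K = dim (K/H) + rk H. Either
    dim (K/H) is 0 and K/H is finite, or it is at least 1. *)
Lemma almost_sub_or_rk_lt : almost_sub K H \/ (rk H < rk K)%N.
Proof.
move: dim_le dim_ge; case Ej : (dim _) => [j|//] /= _.
case: j Ej => [|j] Ej le; last first.
  by right; apply: leq_trans le; rewrite addSn ltnS leq_addl.
left; apply/(@almost_sub_finite_set _ _ (quot_class c K R)).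
- by case: dH.
- by move=> x y Kx Ky; apply: quot_class_eq => //; exact: cc.1.
- suff [] : finite_set (quot c K R) /\ quot c K R !=set0 by [].
  by apply/(dim_finite dimP MT) => //; exact: interpretable_quot.
Qed.

Lemma almost_sub_rk : almost_sub K H -> (rk K <= rk H)%N.
Proof.
move=> KH; suff Ej : dim (quot c K R) = Some 0%N by move: dim_le; rewrite Ej.
apply/(dim_finite dimP MT); first exact: interpretable_quot.
split; last by exists (quot_class c K R 0); exists 0.
have [sH _] := dH.
apply: (almost_sub_finite_set sH _).2 => // x y Kx Ky.
by apply: quot_class_eq => //; exact: cc.1.
Qed.

End Index.

Lemma connected_rk_lt H K : def_subgroup H -> def_subgroup K -> connected K ->
  H `<=` K -> H <> K -> (rk H < rk K)%N.
Proof.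
move=> dH dK cK HK nHK; have [KH|//] := almost_sub_or_rk_lt dH dK HK.
by case: nHK; apply/seteqP; split=> //; exact: cK.
Qed.

(** * Elements annihilated modulo a subgroup: counting incidences in K x g *)

Section Annihilator.
Variables K S : set g.
Hypotheses (dK : def_subgroup K) (dS : def_subgroup S) (cg : connected setT).
Hypothesis KS : forall x, almost_sub K (lie x @^-1` S).

Let A : set g := K `&` [set y | forall x, S (lie x y)].

Let dA : def_subgroup A.
Proof. by apply: def_subgroupI => //; exact: def_subgroup_annihilator. Qed.

Let code := ord_code c c.

Let ccode : coding code.
Proof.
split; first by apply: ord_code_inj; exact: cc.1.
by apply: definable_range_ord; exact: cc.2.
Qed.

Let cfst : coded_fun code fst.
Proof.
apply: (coded_fun_comp (h := fst) (s := lshift d) _ coded_fun_id) => p.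
by apply/funext => i; rewrite /code /ord_code /= (unsplitK (inl i)).
Qed.

Let csnd : coded_fun code snd.
Proof.
apply: (coded_fun_comp (h := snd) (s := @rshift d d) _ coded_fun_id) => p.
by apply/funext => i; rewrite /code /ord_code /= (unsplitK (inr i)).
Qed.

Let cpair V E (e : E -> V -> M) t u : coded_fun e t -> coded_fun e u ->
  coded (pair_code e code) (fun p => (t p.1, u p.1) = p.2).
Proof.
move=> ct cu.
have H (p : E * (g * g)) : (t p.1 = p.2.1 /\ u p.1 = p.2.2) <-> (t p.1, u p.1) = p.2.
  by case: p => x [y z] /=; split=> [[-> ->]|[-> ->]].
apply: coded_ext H _.
have c1 : coded_fun (pair_code e code) (fun p => p.2.1).
  exact: (coded_fun_comp (h := snd) (s := inr) _ cfst).
have c2 : coded_fun (pair_code e code) (fun p => p.2.2).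
  exact: (coded_fun_comp (h := snd) (s := inr) _ csnd).
by apply: coded_and; apply: coded_fun_eq => //; exact: coded_fun_fst.
Qed.

Let cpair_app V E (e : E -> V -> M) t u (P : set (g * g)) :
  coded code P -> coded_fun e t -> coded_fun e u -> coded e (fun x => P (t x, u x)).
Proof.
move=> cP ct cu.
have := coded_exists ccode.2 (P := fun x q => (t x, u x) = q /\ P q)
  (coded_and (cpair ct cu) (coded_snd e cP)).
by apply: coded_ext => x; split=> [[q [<- //]]|Px]; exists (t x, u x).
Qed.

Let dim_fst_le (P : set (g * g)) (Q : set g) k : coded code P -> coded c Q ->
  (forall p, P p -> Q p.1) ->
  (forall y, Q y -> dimval_le (dimset dim c [set x | P (y, x)]) (Some k)) ->
  dimval_le (dimset dim code P) (dimval_add (dimset dim c Q) k).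
Proof.
move=> cP cQ PQ H.
apply: (dim_quot_le dimP MT ccode cc (phi := fst)) => //.
- exact: coded_rel_eq.
- exact: equiv_on_eq.
- exact: coded_rel_eq.
- exact: equiv_on_eq.
- by move=> p q _ _ ->.
move=> y Qy; apply: dimval_le_trans (H y Qy).
apply: (dimset_inj dimP MT (phi := snd)) => //.
- by apply: coded_and => //; apply: coded_fun_eq => //; exact: coded_fun_const.
- exact: cpair_app cP (coded_fun_const c y) coded_fun_id.
- by move=> [y' x] /= [Pyx <-].
- by move=> [y1 x1] [y2 x2] /= [_ ->] [_ ->] ->.
Qed.

Let dim_snd_ge (P : set (g * g)) k : coded code P ->
  (forall x, dimval_le (Some k) (dimset dim c [set y | P (y, x)])) ->
  dimval_le (dimval_add (dimset dim c setT) k) (dimset dim code P).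
Proof.
move=> cP H.
apply: (dim_quot_ge dimP MT ccode cc (phi := snd)) => //.
- exact: coded_rel_eq.
- exact: equiv_on_eq.
- exact: coded_true.
- exact: coded_rel_eq.
- exact: equiv_on_eq.
- by move=> p q _ _ ->.
move=> x _; apply: dimval_le_trans (H x) _.
apply: (dimset_inj dimP MT (phi := fun y => (y, x))) => //.
- exact: cpair_app cP coded_fun_id (coded_fun_const c x).
- by apply: coded_and => //; apply: coded_fun_eq => //; exact: coded_fun_const.
- exact: (cpair coded_fun_id (coded_fun_const c x)).
- by move=> y y' _ _ [].
Qed.

Let incid (p : g * g) := K p.1 /\ S (lie p.2 p.1).

Let cK1 : coded code (fun p => K p.1).
Proof. by apply: coded_app cfst; case: dK. Qed.

Let cA1 : coded code (fun p => A p.1).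
Proof. by apply: coded_app cfst; case: dA. Qed.

Let cincid : coded code incid.
Proof.
apply: coded_and cK1 _; apply: coded_app; first by case: dS.
exact: coded_fun_lie.
Qed.

Let cI1 : coded code (fun p => incid p /\ A p.1).
Proof. exact: coded_and. Qed.

Let cI2 : coded code (fun p => incid p /\ ~ A p.1).
Proof. by apply: coded_and => //; exact: coded_not. Qed.

Let cKA : coded c (fun y => K y /\ ~ A y).
Proof. by apply: coded_and; [case: dK|apply: coded_not; case: dA]. Qed.

(** The fibre over any x is K intersected with the preimage of S under [x, -]. By [KS] it has finite
    index in K, so it keeps the full rank of K. *)
Let incid_ge : dimval_le (Some (rk setT + rk K)%N) (dimset dim code incid).
Proof.
have -> : Some (rk setT + rk K)%N = dimval_add (dimset dim c setT) (rk K).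
  by rewrite (@dim_rk _ 0) //; exact: coded_true.
apply: dim_snd_ge => // x.
have dKx : def_subgroup (K `&` lie x @^-1` S).
  by apply: def_subgroupI => //; exact: def_subgroup_preimage.
have : (rk K <= rk (K `&` lie x @^-1` S))%N.
  apply: (almost_sub_rk dKx dK).
  apply: almost_subI => //; last exact: almost_sub_sub.
    by case: dK.
  by case: (def_subgroup_preimage x dS).
rewrite -[(_ <= _)%N]/(dimval_le (Some _) (Some _)).
rewrite -(@dim_rk (K `&` lie x @^-1` S) 0).
- move=> /dimval_le_trans; apply; apply: (dimset_sub dimP MT) => //; first by case: dKx.
  + exact: cpair_app cincid coded_fun_id (coded_fun_const c x).
- by case: dKx.
- by case: dKx => -[].
Qed.

Let incid_in_le : dimval_le (dimset dim code (fun p => incid p /\ A p.1))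
                            (Some (rk setT + rk A)%N).
Proof.
rewrite addnC.
have -> : Some (rk A + rk setT)%N = dimval_add (dimset dim c A) (rk setT).
  by rewrite (@dim_rk _ 0) //; [case: dA|case: dA => -[]].
apply: dim_fst_le => //; [by case: dA|by move=> p []|].
move=> y Ay; rewrite -(@dim_rk _ 0) //; last exact: coded_true.
apply: (dimset_sub dimP MT) => //; last exact: coded_true.
exact: cpair_app cI1 (coded_fun_const c y) coded_fun_id.
Qed.

(** The subgroup of the x with [x, y] in S is proper because y is not in A, and [g] is connected, so
    its rank drops. *)
Let centr_rk y : K y -> ~ A y ->
  def_subgroup [set x | S (lie x y)] /\ (rk [set x | S (lie x y)] < rk setT)%N.
Proof.
move=> Ky nAy.
have dy : def_subgroup [set x | S (lie x y)].
  split; last first.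
    apply: coded_app; first by case: dS.
    exact: coded_fun_lie coded_fun_id (coded_fun_const c y).
  have [sS _] := dS; split=> [|x x' Sx Sx'] /=; last by rewrite lieBl; exact: sS.2.
  by rewrite lieC lier0 oppr0; exact: sS.1.
split=> //; apply: connected_rk_lt => //; first exact: def_subgroup_setT.
move=> yT; apply: nAy; split=> // x.
by have : [set: g] x by []; rewrite -yT.
Qed.

Let incid_out_le : dimval_le (dimset dim code (fun p => incid p /\ ~ A p.1))
  (dimval_add (dimset dim c (fun y => K y /\ ~ A y)) (rk setT).-1).
Proof.
apply: dim_fst_le => // [p [[Kp _] //]|y [Ky nAy]].
have [dy lt] := centr_rk Ky nAy.
have : (rk [set x | S (lie x y)] <= (rk setT).-1)%N.
  by rewrite -ltnS (ltn_predK lt).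
rewrite -[(_ <= _)%N]/(dimval_le (Some _) (Some _)).
rewrite -(@dim_rk [set x | S (lie x y)] 0).
- apply: dimval_le_trans; apply: (dimset_sub dimP MT) => //.
  + exact: cpair_app cI2 (coded_fun_const c y) coded_fun_id.
  + by case: dy.
  + by move=> x [[]].
- by case: dy.
- by case: dy => -[].
Qed.

(* The set of the pairs (y, x) in K x g with [x, y] in S has dimension at least
   dim g + dim K, as seen from the x side. Seen from the y side, the fibre over
   y has dimension < dim g unless it is g, that is, unless y lies in A. *)
Lemma almost_sub_annihilator :
  almost_sub K (K `&` [set y | forall x, S (lie x y)]).
Proof.
have [//|lt] := almost_sub_or_rk_lt dA dK (fun y => @proj1 _ _).
exfalso; move: incid_ge.
have -> : incid = (fun p => incid p /\ A p.1) `|` (fun p => incid p /\ ~ A p.1).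
  apply/seteqP; split=> p; last by move=> [] [].
  by move=> Ip; have [Ap|nAp] := pselect (A p.1); [left|right].
rewrite (dimset_setU dimP) //.
set N := (rk setT + rk K)%N; set X := dimset _ _ _; set Y := dimset _ _ _.
have N_gt0 : (0 < N)%N by rewrite addn_gt0 (leq_ltn_trans _ lt) ?orbT.
have XN : dimval_le X (Some N.-1).
  apply: dimval_le_trans incid_in_le _ => /=.
  by rewrite -ltnS prednK // ltn_add2l.
(* If K minus A is empty, then Y is -oo. Otherwise [centr_rk] gives 0 < rk g, so that the
   predecessor in [incid_out_le] is a genuine loss of one. *)
have YN : dimval_le Y (Some N.-1).
  apply: dimval_le_trans incid_out_le _.
  have [[y [Ky nAy]]|ne] := pselect (exists y, K y /\ ~ A y); last first.
    by rewrite (dimset0 dimP) // => y yP; apply: ne; exists y.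
  have [_ /(leq_ltn_trans (leq0n _)) g_gt0] := centr_rk Ky nAy.
  have : dimval_le (dimset dim c (fun y => K y /\ ~ A y)) (Some (rk K)).
    rewrite -(@dim_rk K 0); [|by case: dK|by case: dK => -[]].
    by apply: (dimset_sub dimP MT) => //; [case: dK|move=> z []].
  case: (dimset dim c _) => //= k kK.
  by rewrite -ltnS prednK // /N -[rk setT](prednK g_gt0) addSn ltnS addnC leq_add2l.
by rewrite /dimval_max; case: ifP => _ /dimval_le_trans H;
  [move: (H _ YN)|move: (H _ XN)]; rewrite /= leqNgt prednK // leqnn.
Qed.

End Annihilator.

(** * Chains of subgroups modulo an ideal *)

Lemma rk_sub H K : def_subgroup H -> def_subgroup K -> H `<=` K -> (rk H <= rk K)%N.
Proof.
move=> [sH cH] [sK cK] HK; have := dimset_sub dimP MT cc cH cK HK.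
by rewrite (dim_rk cH sH.1) (dim_rk cK sK.1).
Qed.

Definition sums (Z : set g) (As : seq (set g)) := foldr (@sumset g) Z As.

Lemma def_subgroup_sums Z As : def_subgroup Z ->
  (forall A, A \in As -> def_subgroup A) -> def_subgroup (sums Z As).
Proof.
move=> dZ; elim: As => //= A As IH dA; apply: def_subgroup_sumset.
  by apply: dA; exact: mem_head.
by apply: IH => B BAs; apply: dA; rewrite inE BAs orbT.
Qed.

Lemma sub_sums_base Z As : (forall A, A \in As -> def_subgroup A) -> Z `<=` sums Z As.
Proof.
elim: As => [|A As IH] dA x Zx //=; apply: sumset_subr.
  by case: (dA A (mem_head _ _)).
by apply: IH => // B BAs; apply: dA; rewrite inE BAs orbT.
Qed.

Lemma sums_sub Z As J : subgroup J -> Z `<=` J -> (forall A, A \in As -> A `<=` J) ->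
  sums Z As `<=` J.
Proof.
move=> sJ ZJ; elim: As => //= A As IH AJ; apply: sumset_sub => //.
  by apply: AJ; exact: mem_head.
by apply: IH => B BAs; apply: AJ; rewrite inE BAs orbT.
Qed.

Lemma connected_sums Z As : def_subgroup Z -> connected Z ->
  (forall A, A \in As -> def_subgroup A) ->
  (forall A, A \in As -> connected A) -> connected (sums Z As).
Proof.
move=> dZ cZ; elim: As => //= A As IH dA cA.
have dAs C : C \in As -> def_subgroup C.
  by move=> CAs; apply: dA; rewrite inE CAs orbT.
apply: connected_sumset.
- by case: (dA A (mem_head _ _)).
- by case: (def_subgroup_sums dZ dAs).
- by apply: cA; exact: mem_head.
- by apply: IH => // B BAs; apply: cA; rewrite inE BAs orbT.
Qed.

(** Take a finite sum of members of F, together with Z, of maximal rank, the ranks being bounded by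
    that of [g]. A further summand cannot raise the rank, so it is almost contained in the sum. *)
Lemma max_sums Z (F : set g -> Prop) : def_subgroup Z ->
  (forall A, F A -> def_subgroup A) ->
  exists As, (forall A, A \in As -> F A) /\
    forall A, F A -> almost_sub A (sums Z As).
Proof.
move=> dZ dF.
pose p n := `[< exists2 As, forall A, A \in As -> F A & rk (sums Z As) = n >].
have exp : exists n, p n by exists (rk Z); apply/asboolP; exists [::].
have ubp n : p n -> (n <= rk setT)%N.
  move=> /asboolP[As FAs <-]; apply: rk_sub => //; last exact: def_subgroup_setT.
  by apply: def_subgroup_sums => // A /FAs/dF.
case: (ex_maxnP exp ubp) => n /asboolP[As FAs rkn] maxn.
exists As; split=> // A FA.
have dAs B : B \in As -> def_subgroup B by move=> /FAs/dF.
have dS := def_subgroup_sums dZ dAs.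
have [AS|] := almost_sub_or_rk_lt dS (def_subgroup_sumset (dF _ FA) dS)
  (sumset_subr (dF _ FA).1).
  by apply: almost_subl AS; apply: sumset_subl; case: dS.
rewrite rkn ltnNge maxn //; apply/asboolP; exists (A :: As) => // B.
by rewrite inE => /orP[/eqP ->|/FAs].
Qed.

Definition def_ideal (I : set g) := def_subgroup I /\ lie_stable I.

Lemma def_ideal_sums Z As : def_ideal Z -> (forall A, A \in As -> def_subgroup A) ->
  (forall x A, A \in As -> lie x @` A `<=` sums Z As) -> def_ideal (sums Z As).
Proof.
move=> [dZ iZ] dAs AsS; have dS := def_subgroup_sums dZ dAs; split=> // x.
apply: (@sums_sub Z As (lie x @^-1` sums Z As)).
- by case: (def_subgroup_preimage x dS).
- by move=> y /iZ Zxy; apply: sub_sums_base.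
- by move=> A AAs y Ay; apply: (AsS x A AAs); exists y.
Qed.

Section ModuloIdeal.
Variables Z h : set g.
Hypotheses (iZ : def_ideal Z) (ih : def_ideal h) (Zh : Z `<=` h).

Let dZ : def_subgroup Z := iZ.1.

(* Modulo Z: the definable subgroups of A are finite or of finite index. *)
Definition quasi_minimal A := forall B, def_subgroup B -> Z `<=` B ->
  almost_sub (A `&` B) Z \/ almost_sub A B.

(** Connectedness of the image of A in g/Z: only subgroups containing Z are tested. *)
Definition quasi_connected A := forall B, def_subgroup B -> Z `<=` B ->
  almost_sub A B -> A `<=` B.

Let preimageZ x (B : set g) : Z `<=` B -> Z `<=` lie x @^-1` B.
Proof. by move=> ZB y Zy; apply: ZB; exact: iZ.2. Qed.

Lemma quasi_minimal_image x A : quasi_minimal A -> quasi_minimal (lie x @` A).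
Proof.
move=> qA B dB ZB.
have [AZ|AB] := qA _ (def_subgroup_preimage x dB) (preimageZ x ZB).
  left; have := almost_sub_image (lieBr x) AZ.
  move=> /(fun H => almost_subr H (_ : _ `<=` Z)) H.
  apply: almost_subl (H _); first by move=> _ [[y Ay <-] By]; exists y.
  by move=> _ [y Zy <-]; exact: iZ.2.
right; apply: almost_subr (almost_sub_image (lieBr x) AB) _.
by move=> _ [y By <-].
Qed.

Lemma quasi_connected_image x A : quasi_connected A -> quasi_connected (lie x @` A).
Proof.
move=> cA B dB ZB AB _ [y Ay <-].
apply: (cA _ (def_subgroup_preimage x dB) (preimageZ x ZB)) => //.
by apply: almost_sub_preimage => //; [exact: lieBr|case: dB].
Qed.

(** [almost_sub] with its list made explicit, so that translates can be counted. *)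
Definition covers (K H : set g) (s : seq g) :=
  forall x, K x -> exists2 a, a \in s & H (x - a).

Lemma covers_rem A B C x s : subgroup A -> subgroup B -> subgroup C -> C `<=` B ->
  A x -> B x -> ~ C x -> covers A C s ->
  exists2 t, (size t < size s)%N & covers A B t.
Proof.
move=> sA sB sC CB Ax Bx nCx As.
have [a sa Cxa] := As x Ax; have [b sb] := As 0 sA.1.
rewrite sub0r => /(subgroupN sC); rewrite opprK => Cb.
have ab : a != b.
  by apply/eqP => ab; apply: nCx; rewrite -(subrK a x) {2}ab; exact: subgroupD.
exists (rem a s) => [|y Ay].
  by rewrite size_rem // prednK //; case: (s) sa.
have [e se Cye] := As y Ay; have [ea|ea] := eqVneq e a; last first.
  by exists e; [rewrite rem_mem|exact: CB].
exists b; first by rewrite rem_mem // eq_sym.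
have -> : y - b = (y - e) - (x - a) + (x - b).
  by rewrite ea opprB !addrA !subrK.
apply: subgroupD => //; first by apply: CB; exact: sC.2.
by apply: sB.2 => //; exact: CB.
Qed.

(** The length of [s] bounds all the indices, so some B of finite index needs the largest number of
    translates to cover A. If some C missed a point of A and B, the intersection of C and B would
    need one more, by [covers_rem]. *)
Lemma quasi_connected_component A s : def_subgroup A ->
  (forall B, def_subgroup B -> Z `<=` B -> almost_sub A B -> covers A B s) ->
  exists B, [/\ def_subgroup B, Z `<=` B, almost_sub A B &
    forall C, def_subgroup C -> Z `<=` C -> almost_sub A C -> A `&` B `<=` C].
Proof.
move=> dA As.
pose good B := [/\ def_subgroup B, Z `<=` B & almost_sub A B].
pose p n := `[< exists2 B, good B & forall t, covers A B t -> (n <= size t)%N >].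
have exp : exists n, p n.
  exists 0%N; apply/asboolP; exists setT => //; split=> //.
    exact: def_subgroup_setT.
  exact: almost_sub_sub.
have ubp n : p n -> (n <= size s)%N.
  by move=> /asboolP[B [dB ZB AB]]; apply; exact: As.
case: (ex_maxnP exp ubp) => n /asboolP[B [dB ZB AB] Bn] maxn.
exists B; split=> // C dC ZC AC x [Ax Bx]; apply: contrapT => nCx.
suff /maxn : p n.+1 by rewrite ltnn.
apply/asboolP; exists (C `&` B).
  split; [exact: def_subgroupI|by move=> y Zy; split; [exact: ZC|exact: ZB]|].
  by apply: almost_subI => //; [case: dC|case: dB].
move=> t; case: dA dB (def_subgroupI dC dB) => sA _ [sB _] [sCB _].
move=> /(covers_rem sA sB sCB (fun y => @proj2 _ _) Ax Bx (fun Cx => nCx Cx.1)).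
by move=> [t' tt' /Bn nt']; exact: leq_ltn_trans nt' tt'.
Qed.

(* The image of P in (A + S)/S, with A the first summand not redundant for P, is
   isogenous to a subgroup A' of A, so that the indices of the definable
   subgroups of finite index in A' are bounded. *)
Lemma quasi_minimal_connected As P :
  (forall A, A \in As -> def_subgroup A) -> (forall A, A \in As -> quasi_minimal A) ->
  def_subgroup P -> connected P -> P `<=` sums Z As -> ~ P `<=` Z ->
  exists A, [/\ def_subgroup A, quasi_minimal A, quasi_connected A, ~ A `<=` Z &
    exists2 A0, A0 \in As & A `<=` A0].
Proof.
move=> dAs0 qAs0 dP cP; elim: As dAs0 qAs0 => //= A As IH dAs0 qAs0 PAS nPZ.
have dA := dAs0 A (mem_head _ _); have qA := qAs0 A (mem_head _ _).
have dAs B : B \in As -> def_subgroup B.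
  by move=> BAs; apply: dAs0; rewrite inE BAs orbT.
have qAs B : B \in As -> quasi_minimal B.
  by move=> BAs; apply: qAs0; rewrite inE BAs orbT.
set S := sums Z As in PAS; have dS : def_subgroup S by exact: def_subgroup_sums.
have ZS : Z `<=` S by exact: sub_sums_base.
have [PS|nPS] := pselect (P `<=` S).
  have [B [dB qB cB nBZ [B0 B0As BB0]]] := IH dAs qAs PS nPZ.
  by exists B; split=> //; exists B0; rewrite // inE B0As orbT.
(* If A is almost contained in S, so is P, and connectedness puts P inside S. Hence the part of A in
   S is finite modulo Z, covered by the list [s]. *)
have [[s sP]|AS] := qA S dS ZS; last first.
  case: nPS; apply: cP => //; apply: almost_subl PAS _.
  by apply: almost_sub_sumset => //; [case: dS|exact: almost_sub_sub].
pose A' := A `&` sumset P S.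
have dA' : def_subgroup A' by apply: def_subgroupI => //; exact: def_subgroup_sumset.
have PA'S : P `<=` sumset A' S.
  move=> p Pp; have [a Aa [u Su pE]] := PAS p Pp; exists a; last by exists u.
  split=> //; exists p => //; exists (- u); first by apply: subgroupN => //; case: dS.
  by rewrite -pE addrK.
have PB B : def_subgroup B -> almost_sub A' B -> P `<=` sumset (A' `&` B) S.
  move=> dB A'B; apply: cP.
    by apply: def_subgroup_sumset => //; exact: def_subgroupI.
  apply: almost_subl PA'S _; apply: almost_sub_sumset.
  - by have [] := def_subgroup_sumset (def_subgroupI dA' dB) dS.
  - apply: (@almost_subr _ _ (A' `&` B)); last by apply: sumset_subl; case: dS.
    by apply: almost_subI => //; [case: dA'|case: dB|exact: almost_sub_sub].
  - apply/almost_sub_sub/sumset_subr.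
    by case: (def_subgroupI dA' dB).
(* By [PB], each a in A' differs from some b in A' and B by an element of A and S. The list [s],
   which does not depend on B, therefore covers A' modulo B. *)
have A's B : def_subgroup B -> Z `<=` B -> almost_sub A' B -> covers A' B s.
  move=> dB ZB A'B a [Aa [p /(PB B dB A'B)[b [[Ab _] Bb] [u Su <-]] [w Sw aE]]].
  have [|e se Ze] := sP (a - b).
    split; first by case: dA => -[_ AB] _; exact: AB.
    by rewrite -aE -(addrA b) addrAC subrr add0r; case: dS => sS _; exact: subgroupD.
  exists e => //; have -> : a - e = (a - b - e) + b by rewrite addrAC subrK.
  by case: (dB) => sB _; apply: subgroupD => //; exact: ZB.
have [B [dB ZB A'B minB]] := quasi_connected_component dA' A's.
have sub : A' `&` B `<=` A by move=> x [[]].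
exists (A' `&` B); split.
- exact: def_subgroupI.
- move=> C dC ZC; have [AC|AC] := qA C dC ZC.
    by left; apply: almost_subl AC => x [/sub].
  by right; apply: almost_subl AC.
- move=> C dC ZC A'BC; apply: minB => //; apply: almost_sub_trans A'BC.
  by apply: almost_subI => //; [case: dA'|case: dB|exact: almost_sub_sub].
- move=> A'BZ; apply: nPS => p /(PB B dB A'B)[b /A'BZ/ZS Sb [u Su <-]].
  by case: dS => sS _; exact: subgroupD.
- by exists A; rewrite ?mem_head.
Qed.

(** The DCC of S modulo Z, stated for the traces on S of chains of definable subgroups of [g]. The
    chains need not lie in S, as the case of sums requires. *)
Definition stable_on S := forall B : nat -> set g,
  (forall i, def_subgroup (B i)) -> (forall i, Z `<=` B i) ->
  (forall i, B i.+1 `<=` B i) ->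
  exists N, forall i, (N <= i)%N -> B N `&` S `<=` B i.

Lemma chain_sub (B : nat -> set g) : (forall i, B i.+1 `<=` B i) ->
  forall i j, (i <= j)%N -> B j `<=` B i.
Proof.
move=> dec i; elim=> [|j IH]; first by rewrite leqn0 => /eqP ->.
rewrite leq_eqVlt => /orP[/eqP -> //|]; rewrite ltnS => /IH Bij x Bx.
exact/Bij/dec.
Qed.

(** If no trace of the chain on A is finite modulo Z, quasi-minimality and quasi-connectedness put A
    inside every B i. Otherwise the chain stops at a trace covered by the least number of translates
    of Z. *)
Lemma stable_on_minimal A : def_subgroup A -> quasi_minimal A -> quasi_connected A ->
  stable_on A.
Proof.
move=> dA qA cA B dB ZB dec.
have [[i [t tP]]|nfin] := pselect (exists i, almost_sub (A `&` B i) Z); last first.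
  exists 0%N => i _ x [_ Ax].
  have [fin|AB] := qA (B i) (dB i) (ZB i); first by case: nfin; exists i.
  by apply: (cA (B i)).
pose p n := `[< exists i t, covers (A `&` B i) Z t /\ size t = n >].
have exp : exists n, p n by exists (size t); apply/asboolP; exists i, t.
case: (ex_minnP exp) => n /asboolP[N [s [sP sn]]] minn.
exists N => j Nj x [Bx Ax]; apply: contrapT => nBx.
have [a sa Zxa] := sP x (conj Ax Bx).
suff /minn : p (size (rem a s)).
  by rewrite size_rem // sn leqNgt prednK ?leqnn // -sn; case: (s) sa.
apply/asboolP; exists j, (rem a s); split=> // y [Ay By].
have [e se Zye] := sP y (conj Ay (chain_sub dec Nj By)).
exists e => //; rewrite rem_mem //; apply/eqP => ea; apply: nBx.
have -> : x = (x - a) - (y - e) + y by rewrite ea opprB addrA subrK subrK.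
case: (dB j) => sB _; apply: subgroupD => //.
by apply: sB.2; exact: ZB.
Qed.

(** As for an extension of Artinian modules: once B i is stationary on S and B i + S is stationary
    on A, the chain is stationary on A + S. *)
Lemma stable_on_sumset A S : def_subgroup A -> def_subgroup S -> Z `<=` S ->
  stable_on A -> stable_on S -> stable_on (sumset A S).
Proof.
move=> dA dS ZS stA stS B dB ZB dec.
have [N1 N1P] := stS B dB ZB dec.
have [|||N2 N2P] := stA (fun i => sumset (B i) S).
- by move=> i; exact: def_subgroup_sumset.
- by move=> i x /(ZB i); apply: sumset_subl; case: dS.
- by move=> i _ [x /dec Bx [y Sy <-]]; exists x => //; exists y.
exists (maxn N1 N2) => i; rewrite geq_max => /andP[N1i N2i] x [Bx [a Aa [u Su xE]]].
have B2 : (B N2) x by apply: (chain_sub dec _ Bx); exact: leq_maxr.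
have B1 : (B N1) x by apply: (chain_sub dec _ Bx); exact: leq_maxl.
have [|b Bb [w Sw aE]] := N2P i N2i a.
  split=> //; exists x => //; exists (- u); first by apply: subgroupN => //; case: dS.
  by rewrite -xE addrK.
have uE : x - b = w + u by rewrite -xE -aE -(addrA b) addrAC subrr add0r.
rewrite -(subrK b x); case: (dB i) => sBi _; apply: subgroupD => //.
apply: (N1P i N1i); split; last by rewrite uE; apply: subgroupD => //; case: dS.
case: (dB N1) => sB1 _; apply: sB1.2 => //.
exact: (chain_sub dec N1i).
Qed.

Lemma stable_on_sums As : (forall A, A \in As -> def_subgroup A) ->
  (forall A, A \in As -> stable_on A) -> stable_on (sums Z As).
Proof.
elim: As => [|A As IH] dAs sAs /=.
  by move=> B _ ZB _; exists 0%N => i _ x [_ /ZB].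
have dAs' B : B \in As -> def_subgroup B.
  by move=> BAs; apply: dAs; rewrite inE BAs orbT.
apply: stable_on_sumset.
- by apply: dAs; exact: mem_head.
- exact: def_subgroup_sums.
- exact: sub_sums_base.
- by apply: sAs; exact: mem_head.
- by apply: IH => // B BAs; apply: sAs; rewrite inE BAs orbT.
Qed.

Hypothesis cg : connected setT.
Hypothesis ch : connected h.
Hypothesis irr : forall I, def_ideal I -> Z `<=` I -> I `<=` h -> I `<=` Z \/ h `<=` I.
Hypothesis nonannihilated : ~ forall x y, h y -> Z (lie x y).

Lemma exists_quasi_minimal : exists K, [/\ def_subgroup K, K `<=` h,
  ~ almost_sub K Z & quasi_minimal K].
Proof.
pose good K := [/\ def_subgroup K, Z `<=` K, K `<=` h & ~ almost_sub K Z].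
pose p n := `[< exists2 K, good K & rk K = n >].
have exp : exists n, p n.
  (* The ideal h is a candidate: being connected, it would otherwise lie in Z, and then [g, h] would
     lie in Z too. *)
  exists (rk h); apply/asboolP; exists h => //; split=> //; first by case: ih.
  move=> /(ch dZ) hZ; apply: nonannihilated => x y hy.
  by apply: hZ; exact: ih.2.
case: (ex_minnP exp) => n /asboolP[K [dK ZK Kh nKZ] rkK] minn.
exists K; split=> // B dB ZB.
have [KBZ|nKBZ] := pselect (almost_sub (K `&` B) Z); [by left|right].
have dKB := def_subgroupI dK dB.
have [KB|] := almost_sub_or_rk_lt dKB dK (fun x => @proj1 _ _).
  by apply: almost_subr KB _ => x [].
rewrite rkK ltnNge minn //; apply/asboolP; exists (K `&` B) => //; split=> //.
  by move=> x Zx; split; [exact: ZK|exact: ZB].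
by move=> x [/Kh].
Qed.

(* With K quasi-minimal and S a sum of images [x, K] almost containing all of
   them, some [y, g] not in Z is contained in S by almost_sub_annihilator. *)
Lemma exists_quasi_minimal_connected : exists A, [/\ def_subgroup A, A `<=` h,
  ~ A `<=` Z, quasi_minimal A & quasi_connected A].
Proof.
have [K [dK Kh nKZ qK]] := exists_quasi_minimal.
have [|As [FAs maxAs]] := @max_sums Z (fun A => exists x, A = lie x @` K) dZ.
  by move=> _ [x ->]; exact: def_subgroup_image.
have dAs A : A \in As -> def_subgroup A.
  by move=> /FAs[x ->]; exact: def_subgroup_image.
have dS := def_subgroup_sums dZ dAs.
have KS x : almost_sub K (lie x @^-1` sums Z As).
  apply: almost_sub_preimage; [exact: lieBr|by case: dS|].
  by apply: maxAs; exists x.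
have Kann := almost_sub_annihilator dK dS cg KS.
have [y [Ky Sy nZy]] : exists y, [/\ K y, forall x, sums Z As (lie x y) &
    ~ forall x, Z (lie x y)].
  apply: contrapT => ny.
  (* By irreducibility this ideal is inside Z, since h is not annihilated modulo Z. Without the
     required y, almost all of K would lie in it, and K would be finite modulo Z. *)
  pose I := h `&` [set y | forall x, Z (lie x y)].
  have iI : def_ideal I.
    split; first by apply: def_subgroupI; [case: ih|exact: def_subgroup_annihilator].
    move=> x y [hy Zy]; split; first exact: ih.2.
    by move=> x'; apply: iZ.2; exact: Zy.
  have [||IZ|hI] := irr iI.
  - by move=> y Zy; split; [exact: Zh|move=> x; exact: iZ.2].
  - by move=> y [].
  - apply: nKZ; apply: almost_subr Kann _ => y [Ky Sy]; apply: IZ.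
    split; first exact: Kh.
    by apply: contrapT => nZy; apply: ny; exists y.
  - by apply: nonannihilated => x y /hI[_]; apply.
have [|||||A [dA qA cA nAZ [A0 /FAs[x ->] AA0]]] :=
    @quasi_minimal_connected As (lie y @` setT) dAs.
- by move=> A /FAs[x ->]; exact: quasi_minimal_image.
- exact/def_subgroup_image/def_subgroup_setT.
- exact: connected_image.
- move=> _ [x _ <-]; rewrite lieC; apply: subgroupN; first by case: dS.
  exact: Sy.
- move=> yZ; apply: nZy => x; rewrite lieC; apply: subgroupN; first by case: dZ.
  by apply: yZ; exists x.
exists A; split=> // z /AA0[w /Kh hw <-]; exact: ih.2.
Qed.

(** A maximal sum of quasi-minimal quasi-connected subgroups contains all of them, by
    quasi-connectedness. This family is closed under brackets with [g], so the sum is an ideal; it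
    is not inside Z, hence it contains h. *)
Lemma stable_on_irreducible : stable_on h.
Proof.
have [A [dA Ah nAZ qA cA]] := exists_quasi_minimal_connected.
pose F B := [/\ def_subgroup B, B `<=` h, quasi_minimal B & quasi_connected B].
have [|As [FAs maxAs]] := @max_sums Z F dZ; first by move=> B [].
have dAs B : B \in As -> def_subgroup B by move=> /FAs[].
have dS := def_subgroup_sums dZ dAs.
have ZS : Z `<=` sums Z As by exact: sub_sums_base.
have FS B : F B -> B `<=` sums Z As.
  by move=> FB; have [_ _ _] := FB; apply => //; exact: maxAs.
have iS : def_ideal (sums Z As).
  apply: def_ideal_sums => // x B /FAs[dB Bh qB cB]; apply: FS; split.
  - exact: def_subgroup_image.
  - by move=> _ [y /Bh hy <-]; exact: ih.2.
  - exact: quasi_minimal_image.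
  - exact: quasi_connected_image.
have stS : stable_on (sums Z As).
  by apply: stable_on_sums => // B /FAs[dB _ qB cB]; exact: stable_on_minimal.
have [|SZ|hS] := irr iS ZS.
- by apply: sums_sub => //; [case: ih => -[]|move=> B /FAs[]].
- by case: nAZ => x Ax; apply: SZ; apply: (FS A).
- move=> B dB ZB dec; have [N NP] := stS B dB ZB dec.
  by exists N => i Ni x [Bx hx]; apply: (NP i Ni); split=> //; exact: hS.
Qed.

End ModuloIdeal.

(** * Quotient Lie rings *)

Lemma definable_inE S : definable_in c S <-> coded c S.
Proof.
split; first exact: (coded_image (P := S) cc.1).
exact: (definable_image cc.2).
Qed.

Lemma finite_indexE (A : zmodType) (H : set A) (K : zmodClosed A) :
  finite_index H K <-> almost_sub H [set` K].
Proof.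
apply: (@almost_sub_finite_set A _ (fun x => [set y | y - x \in K])).
  by split=> [|x y]; rewrite /= ?rpred0 //; exact: rpredB.
move=> x y _ _; split=> [xy|Kxy].
  have : [set z | z - x \in K] x by rewrite /= subrr rpred0.
  by rewrite xy.
apply/seteqP; split=> z /= Kz.
  by rewrite -(subrK x z) -addrA rpredD.
by rewrite -(subrK y z) -addrA rpredD // -opprB rpredN.
Qed.

Section Quotient.
Variables h k : lieIdeal g.
Hypothesis kh : [set` k] `<=` [set` h].

Let pi (x : g) : {ideal_quot k} := \pi_{ideal_quot k} x.

Let piB : {morph pi : x y / x - y}. Proof. by move=> x y; exact: raddfB. Qed.

Let pi_eq0 x : pi x = 0 <-> x \in k.
Proof.
rewrite -[X in X \in _]subr0 Quotient.idealrBE /pi.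
split=> [->|/eqP ->]; last exact: raddf0.
by apply/eqP/esym; exact: raddf0.
Qed.

Let pi_lie x y : lie (pi x) (pi y) = pi (lie x y).
Proof. exact: quot_lie_pi. Qed.

Lemma abelian_quot_of_lie :
  (forall x y, x \in h -> y \in h -> lie x y \in k) -> abelian_quot h k.
Proof.
by move=> hk _ _ [x hx <-] [y hy <-]; rewrite pi_lie; apply/pi_eq0; exact: hk.
Qed.

Section Subgroup.
Variable S : zmodClosed {ideal_quot k}.

Definition quot_preimage : set g := pi @^-1` [set` S].

Lemma subgroup_quot_preimage : subgroup quot_preimage.
Proof.
split; first by rewrite /quot_preimage /preimage /= [pi 0]raddf0 rpred0.
by move=> x y Sx Sy; rewrite /quot_preimage /preimage /= piB rpredB.
Qed.

Lemma def_subgroup_quot_preimage :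
  definable_in_quot c [set` S] -> def_subgroup quot_preimage.
Proof. by move=> /definable_inE cS; split=> //; exact: subgroup_quot_preimage. Qed.

Lemma sub_quot_preimage : [set` k] `<=` quot_preimage.
Proof. by move=> x /pi_eq0 x0; rewrite /quot_preimage /preimage /= x0 rpred0. Qed.

Lemma quot_preimage_sub : [set` S] `<=` quot_set h k -> quot_preimage `<=` [set` h].
Proof.
move=> Sh x /Sh[y /= hy yx]; rewrite -(subrK y x); apply: rpredD => //.
by apply: kh; apply/pi_eq0; rewrite piB -yx subrr.
Qed.

Lemma quot_set_sub : [set` h] `<=` quot_preimage -> quot_set h k `<=` [set` S].
Proof. by move=> hS _ [x /hS Sx <-]. Qed.

Lemma finite_index_quot :
  finite_index (quot_set h k) S <-> almost_sub [set` h] quot_preimage.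
Proof.
split=> [/finite_indexE[s sP]|[s sP]].
  exists (map repr s) => x hx; have [|a sa Sa] := sP (pi x); first by exists x.
  exists (repr a); first exact: map_f.
  by rewrite /quot_preimage /preimage /= piB {2}/pi reprK.
apply/finite_indexE; exists (map pi s) => _ [x /sP[a sa Sa] <-].
by exists (pi a); [exact: map_f|rewrite -[X in X - _]/(pi x) -piB].
Qed.

End Subgroup.

Lemma connected_quot_of_connected : connected [set` h] -> connected_quot c h k.
Proof.
move=> ch [S [dS [Sh hS] fS]]; apply: hS; apply: quot_set_sub.
by apply: ch; [exact: def_subgroup_quot_preimage|exact/finite_index_quot].
Qed.

Lemma minimal_quot_of_irreducible :
  (forall I, def_ideal I -> [set` k] `<=` I -> I `<=` [set` h] ->
    I `<=` [set` k] \/ [set` h] `<=` I) ->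
  minimal_quot c h k.
Proof.
move=> irr [S [dS Sh iS infS nfS]].
have iI : def_ideal (quot_preimage S).
  split; first exact: def_subgroup_quot_preimage.
  by move=> x y Sy; have := iS x _ Sy; rewrite [lie _ _]pi_lie.
have [Ik|hI] := irr _ iI (@sub_quot_preimage S) (quot_preimage_sub Sh).
  apply: infS; apply: (sub_finite_set _ (finite_set1 0)) => p.
  elim/quotW: p => x Sx; apply/pi_eq0; exact: Ik.
by apply: nfS; apply/finite_index_quot/almost_sub_sub.
Qed.

(** The preimages in [g] of a descending chain contain k; where they become stationary on h, the
    next inclusion of the chain is not strict. *)
Lemma dcc_quot_of_stable : stable_on [set` k] [set` h] -> dcc_quot c h k.
Proof.
move=> st [K KP].
have dec i : quot_preimage (K i.+1) `<=` quot_preimage (K i).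
  by have [_ _ [sub _]] := KP i; move=> x; exact: sub.
have [N NP] := st (fun i => quot_preimage (K i))
  (fun i => def_subgroup_quot_preimage (let: And3 dK _ _ := KP i in dK))
  (fun i => @sub_quot_preimage (K i)) dec.
have [_ Kh _] := KP N; have [_ _ [_]] := KP N; apply=> p Kp.
have [x hx xp] := Kh p Kp; rewrite -xp.
by apply: (NP N.+1 (leqnSn N)); split=> //; rewrite /quot_preimage /preimage /= [pi x]xp.
Qed.

End Quotient.

Lemma connected_of_connected_group (H : set g) :
  def_subgroup H -> connected_group (definable_in c) H -> connected H.
Proof.
move=> [sH cH] conn K [sK cK] HK; apply: contrapT => nHK; apply: conn.
have [sHK cHK] : def_subgroup (H `&` K) by exact: def_subgroupI.
have [J JE] := exists_zmodClosed sHK.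
exists J; rewrite JE; split; first exact/definable_inE.
  by split=> [x []//|HHK]; apply: nHK => x /HHK[].
by apply/finite_indexE; rewrite JE; apply: almost_subI => //; exact: almost_sub_sub.
Qed.

(** * Series whose factors are of the two required kinds *)

Definition good_factor (a b : lieIdeal g) :=
  abelian_quot a b \/
  [/\ connected_quot c a b, minimal_quot c a b & dcc_quot c a b].

Definition good_series (a : lieIdeal g) := exists (n : nat) (h : nat -> lieIdeal g),
  [/\ h 0%N = a,
      [set` h n] = [set 0],
      forall i, (i <= n)%N -> definable_in c [set` h i],
      forall i, (i < n)%N -> [set` h i.+1] `<=` [set` h i] &
      forall i, (i < n)%N -> good_factor (h i) (h i.+1)].

Lemma good_series0 (a : lieIdeal g) : [set` a] = [set 0] -> good_series a.
Proof.
move=> a0; exists 0%N, (fun=> a); split=> // i _.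
by rewrite a0; apply/definable_inE; case: def_subgroup0.
Qed.

Lemma good_series_cons (a b : lieIdeal g) : definable_in c [set` a] ->
  [set` b] `<=` [set` a] -> good_factor a b -> good_series b -> good_series a.
Proof.
move=> da ba fab [n [h [h0 hn hd hs hf]]].
exists n.+1, (fun i => if i is j.+1 then h j else a); split=> //.
- by case=> [//|i]; exact: hd.
- by case=> [_|i]; [rewrite h0|exact: hs].
- by case=> [_|i]; [rewrite h0|exact: hf].
Qed.

Section Factor.
Hypothesis cg : connected setT.
Variables k h : set g.
Hypotheses (ik : def_ideal k) (ih : def_ideal h) (kh : k `<=` h).
Hypotheses (ck : connected k) (ch : connected h).
Hypothesis maxk : forall J, def_ideal J -> connected J -> J `<=` h -> J <> h ->
  (rk J <= rk k)%N.

(** Z/k is the part of h/k annihilated by [g]. *)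
Let Z : set g := h `&` [set y | forall x, k (lie x y)].

Lemma def_ideal_relative_center : def_ideal Z.
Proof.
split.
  by apply: def_subgroupI; [case: ih|apply: def_subgroup_annihilator; case: ik].
by move=> x y [hy ky]; split=> [|x']; [exact: ih.2|apply: ik.2; exact: ky].
Qed.

Lemma sub_relative_center : k `<=` Z.
Proof. by move=> x kx; split=> [|y]; [exact: kh|exact: ik.2]. Qed.

(* The sum k + [g, J] is connected, hence it is k or h. *)
Lemma relative_center_irreducible J :
  def_ideal J -> Z `<=` J -> J `<=` h -> J `<=` Z \/ h `<=` J.
Proof.
move=> iJ ZJ Jh; have [sk _] := ik.1.
have [|As [FAs maxAs]] := @max_sums k (fun A => exists2 y, J y & A = lie y @` setT) ik.1.
  by move=> _ [y _ ->]; exact/def_subgroup_image/def_subgroup_setT.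
have dAs A : A \in As -> def_subgroup A.
  by move=> /FAs[y _ ->]; exact/def_subgroup_image/def_subgroup_setT.
have dS := def_subgroup_sums ik.1 dAs.
have kS : k `<=` sums k As by exact: sub_sums_base.
(* Each [y, g] is connected, so almost containment is containment: this finite sum is the whole of k
   + [g, J]. *)
have JS y x : J y -> sums k As (lie y x).
  move=> Jy; have cy := @connected_image y _ cg.
  by apply: (cy _ dS); [apply: maxAs; exists y|exists x].
have iS : def_ideal (sums k As).
  apply: def_ideal_sums => // x A /FAs[y Jy ->] _ [_ [z _ <-] <-].
  (* The Jacobi identity as a derivation rule; both terms lie in [J, g] because [x, y] is in J. *)
  have -> : lie x (lie y z) = lie (lie x y) z + lie y (lie x z).
    have := jacobi x y z; rewrite (lieC z (lie x y)) (lieC z x).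
    have -> : lie y (- lie x z) = - lie y (lie x z).
      by rewrite -[- lie x z]sub0r lieBr lier0 sub0r.
    by rewrite -addrA -opprD => /eqP; rewrite subr_eq0 addrC => /eqP.
  by case: dS => sS _; apply: subgroupD => //; apply: JS => //; exact: iJ.2.
have cS : connected (sums k As).
  by apply: connected_sums => // [|A /FAs[y _ ->]]; [case: ik|exact: connected_image].
have SJ : sums k As `<=` J.
  apply: sums_sub; [by case: iJ => -[]|by move=> x /sub_relative_center/ZJ|].
  move=> A /FAs[y Jy ->] _ [z _ <-]; rewrite lieC.
  apply: subgroupN; first by case: iJ => -[].
  exact: iJ.2.
have [Sh|nSh] := pselect (sums k As = h); first by right; rewrite -Sh.
left=> y Jy; split; first exact: Jh.
(* A connected ideal properly inside h has rank at most that of k. The sum is thus almost contained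
   in k, hence inside k, which puts [g, J] in k. *)
have : almost_sub (sums k As) k.
  have [//|] := almost_sub_or_rk_lt ik.1 dS kS.
  by rewrite ltnNge maxk // => x /SJ/Jh.
move=> /(cS _ ik.1) Sk x; rewrite lieC; apply: subgroupN => //.
exact/Sk/JS.
Qed.

End Factor.

Lemma connected0 : connected [set 0].
Proof. by move=> K [[K0 _] _] _ x ->. Qed.

Lemma def_ideal0 : def_ideal [set 0].
Proof. by split; [exact: def_subgroup0|move=> x y ->; exact: lier0]. Qed.

(** Induction on the rank of a. With k of maximal rank among the connected ideals properly inside a,
    and Z/k the part of a/k annihilated by [g], the series starts a, Z, k and goes on below k, whose
    rank is smaller since a is connected. *)
Lemma exists_good_series (a : lieIdeal g) : connected setT ->
  def_subgroup [set` a] -> connected [set` a] -> good_series a.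
Proof.
move=> cg; have [n] := ubnP (rk [set` a]); elim: n a => // n IH a an da ca.
have [a0|na0] := pselect ([set` a] = [set 0]); first exact: good_series0.
have ia : def_ideal [set` a] by split=> // x y ay; exact: lie_idealr.
pose good k := [/\ def_ideal k, connected k, k `<=` [set` a] & k <> [set` a]].
pose p m := `[< exists2 k, good k & rk k = m >].
have exp : exists m, p m.
  exists (rk [set 0]); apply/asboolP; exists [set 0] => //; split.
  - exact: def_ideal0.
  - exact: connected0.
  - by move=> x ->; exact: rpred0.
  - by move=> e; apply: na0; rewrite -e.
have ubp m : p m -> (m <= rk [set` a])%N.
  by move=> /asboolP[k [[dk _] _ ka _] <-]; exact: rk_sub.
case: (ex_maxnP exp ubp) => m /asboolP[k [ik ck ka nka] rkk] maxm.
have maxk J : def_ideal J -> connected J -> J `<=` [set` a] -> J <> [set` a] ->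
    (rk J <= rk k)%N.
  by move=> iJ cJ Ja nJa; rewrite rkk; apply: maxm; apply/asboolP; exists J.
have [b bE] := exists_lieIdeal ik.1.1 ik.2.
have iZ := def_ideal_relative_center ik ia.
set Z := _ `&` _ in iZ; have [z zE] := exists_lieIdeal iZ.1.1 iZ.2.
have kZ : k `<=` Z by exact: sub_relative_center.
have za : [set` z] `<=` [set` a] by rewrite zE => x [].
have bz : [set` b] `<=` [set` z] by rewrite zE bE.
apply: (@good_series_cons a z) => //; first by apply/definable_inE; case: da.
  (* If [g, a] lies in Z, then a/Z is abelian; otherwise a/Z is irreducible and not annihilated by
     [g], and the chain condition applies. *)
  have [ann|nann] := pselect (forall x y, y \in a -> Z (lie x y)).
    left; apply: abelian_quot_of_lie => x y _ ay.
    by have := ann x y ay; rewrite -zE.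
  have irr := relative_center_irreducible cg ik ka ck maxk.
  right; split.
  - exact: connected_quot_of_connected.
  - by apply: minimal_quot_of_irreducible => //; rewrite zE; exact: irr.
  - apply: dcc_quot_of_stable => //; rewrite zE.
    apply: stable_on_irreducible => //.
    by rewrite -zE.
apply: (@good_series_cons z b) => //.
  by apply/definable_inE; rewrite zE; case: iZ => -[].
  left; apply: abelian_quot_of_lie => x y _ zy.
  have [_ ky] : Z y by rewrite -zE.
  by have : [set` b] (lie x y) by rewrite bE; exact: ky.
apply: IH; rewrite ?bE //; last by case: ik.
rewrite -ltnS; apply: leq_trans an; rewrite ltnS.
by apply: connected_rk_lt => //; case: ik.
Qed.

End DefinableSubgroups.

Theorem theorem0p3 (L : language) (T : theory L) (hT : finite_dimensional T)
    (M : fo_structure L) (hM : models M T)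
    (g : lieRingType) (d : nat) (c : g -> ('I_d -> M))
    (hg : definable_lie_ring c)
    (hconn : connected_group (definable_in c) [set: g]) :
  exists (n : nat) (h : nat -> lieIdeal g),
    [/\ [set` h 0%N] = [set: g],
        [set` h n] = [set 0],
        forall i, (i <= n)%N -> definable_in c [set` h i],
        forall i, (i < n)%N -> [set` h i.+1] `<=` [set` h i] &
        forall i, (i < n)%N ->
          abelian_quot (h i) (h i.+1) \/
          [/\ connected_quot c (h i) (h i.+1),
              minimal_quot c (h i) (h i.+1) &
              dcc_quot c (h i) (h i.+1)]].
Proof.
have [dim dimP] := hT.
have dT : def_subgroup c setT by exact: def_subgroup_setT.
have cT := connected_of_connected_group hg dT hconn.
have [a aE] := @exists_lieIdeal g setT dT.1 (fun _ _ _ => I).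
have [||n [h [h0 hn hd hs hf]]] := exists_good_series dimP hM hg (a := a) cT.
- by rewrite aE.
- by rewrite aE.
by exists n, h; split=> //; rewrite h0.
Qed.
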